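(* Let $p$ be a point of Minkowski space $\mathbb{M}^4$, let $\mathbb{R}^3_p$ be the slice $t=t(p)$ through $p$, and let $A^3$ be an open subset of $\mathbb{R}^3_p$. Then projection onto the slice $\mathbb{R}^3_p$ defines a bijective correspondence between germs at $A^3$ of $C^\infty$ shear-free ray congruences $\ell$ defined on an open neighbourhood of $A^3$ in $\mathbb{M}^4$ and $C^\infty$ oriented conformal foliations $\mathcal{C}$ by curves of $A^3$. The inverse of projection is extension.
   Context: $\mathbb{M}^4=\{(t,x_1,x_2,x_3)\in\mathbb{R}^4\}$ with metric $g^M=-dt^2+dx_1^2+dx_2^2+dx_3^2$, Levi-Civita connection $\nabla$ and standard orientations. A ray congruence on an open set $A^M\subset\mathbb{M}^4$ is a smooth foliation $\ell$ of $A^M$ by (open pieces of) affine null lines. Its tangent field is normalized as $w=\partial/\partial t+U$ with $U$ a unit vector field tangent to the slices $t=$ const. Put $W=\mathrm{span}\{w\}$; the orthogonal complement $W^\perp$ with respect to $g^M$ contains $W$. Let $\Sigma\subset W^\perp$ be the screen space consisting of vectors tangent to the slices $t=$ const and orthogonal to $U$ (any other complement of $W$ in $W^\perp$ gives the same notion below), oriented by $U$ and the orientation of $\mathbb{R}^3$; let $J^\perp$ be rotation through $+\pi/2$ on $\Sigma$, and $\{\ \}^\Sigma$ the projection $W^\perp\to\Sigma$ along $W$. The congruence $\ell$ is shear-free at a point if $\{\nabla_{J^\perp X}w\}^\Sigma=J^\perp\{\nabla_Xw\}^\Sigma$ for all $X\in\Sigma$ at that point; it is a shear-free ray congruence if this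 holds at every point. An oriented foliation $\mathcal{C}$ by curves of an open subset $A^3$ of Euclidean $3$-space $(\mathbb{R}^3,g)$, with unit positive tangent field $U$, is conformal if there is a function $\nu$ with $(\mathcal{L}_Ug)(X,Y)=\nu\,g(X,Y)$ for all $X,Y\perp U$. Projection of $\ell$ onto the slice: the foliation of $A^3$ by the integral curves of $U|_{A^3}$ (oriented by $U$). Extension of $\mathcal{C}$: if $U$ is the unit positive tangent of $\mathcal{C}$, the ray congruence (on a neighbourhood of $A^3$) formed by the null lines through the points of $A^3$ tangent to $\partial/\partial t+U$. *)

(* Defs.v *)
From HB Require Import structures.
From mathcomp Require Import all_boot all_order all_algebra.
From mathcomp Require Import all_classical all_reals all_analysis.
Import Order.TTheory GRing.Theory Num.Theory numFieldNormedType.Exports.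

Set Implicit Arguments.
Unset Strict Implicit.
Unset Printing Implicit Defensive.

Local Open Scope classical_set_scope.
Local Open Scope ring_scope.

(* The library norm on row vectors is the sup norm: it is only used for the
   topology.  Euclidean and Minkowski geometry go through [dot] and [gM]. *)

Section Smooth.
Context {R : realType} {V W : normedModType R}.

Fixpoint Ck (n : nat) (A : set V) (f : V -> W) : Prop :=
  match n with
  | 0%N => forall x, A x -> {for x, continuous f}
  | m.+1 => (forall x, A x -> differentiable f x) /\
            (forall v, Ck m A (fun x => 'D_v f x))
  end.

(* Meaningful for open [A]; it then depends only on the values of [f] on [A]. *)
Definition smooth_on (A : set V) (f : V -> W) : Prop := forall n, Ck n A f.

End Smooth.

Section Euclidean.
Context {R : realType}.
Implicit Types (u v x X Y : 'rV[R]_3) (A : set 'rV[R]_3).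

Definition dot u v : R := \sum_(i < 3) u 0 i * v 0 i.

Definition cross u v : 'rV[R]_3 :=
  \row_(i < 3) (u 0 (i + 1) * v 0 (i + 2%:R) - u 0 (i + 2%:R) * v 0 (i + 1)).

(* (L_U h)(X, Y) at x for a field of bilinear forms h, where X and Y are
   extended to constant vector fields, so that [U, X] = - D_X U. *)
Definition lie_derive (U : 'rV[R]_3 -> 'rV[R]_3)
    (h : 'rV[R]_3 -> 'rV[R]_3 -> 'rV[R]_3 -> R) x X Y : R :=
  'D_(U x) (fun y => h y X Y : R^o) x + h x ('D_X U x) Y + h x X ('D_Y U x).

Definition euclidean_metric (x : 'rV[R]_3) := dot.

(* An oriented foliation of [A] by curves is given by its unit positive tangent
   field, extended by 0 outside [A] so that two foliations of [A] are the same
   iff they are equal as functions. *)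
Definition oriented_foliation A (U : 'rV[R]_3 -> 'rV[R]_3) : Prop :=
  [/\ smooth_on A U, (forall x, A x -> dot (U x) (U x) = 1)
    & (forall x, ~ A x -> U x = 0)].

Definition conformal A (U : 'rV[R]_3 -> 'rV[R]_3) : Prop :=
  exists nu : 'rV[R]_3 -> R, forall x, A x -> forall X Y,
    dot X (U x) = 0 -> dot Y (U x) = 0 ->
    lie_derive U euclidean_metric x X Y = nu x * euclidean_metric x X Y.

Definition conformal_foliations A : set ('rV[R]_3 -> 'rV[R]_3) :=
  [set U | oriented_foliation A U /\ conformal A U].

End Euclidean.

Section Minkowski.
Context {R : realType}.
Implicit Types (p q v X Y : 'rV[R]_4) (x : 'rV[R]_3) (A : set 'rV[R]_3).

(* Coordinates (t, x1, x2, x3). *)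
Definition tcoord q : R := q 0 0.
Definition spart q : 'rV[R]_3 := rsubmx (q : 'rV[R]_(1 + 3)).
Definition event (t : R) x : 'rV[R]_4 := row_mx (t%:M : 'rV[R]_1) x.

Definition gM X Y : R := - (tcoord X * tcoord Y) + dot (spart X) (spart Y).

(* The Levi-Civita connection of the constant-coefficient metric [gM]. *)
Definition nabla X (w : 'rV[R]_4 -> 'rV[R]_4) q : 'rV[R]_4 := 'D_X w q.

Definition line q v : set 'rV[R]_4 := [set q + s *: v | s in [set: R]].

(* A ray congruence is represented by its open domain B together with the
   spatial part U of its normalized tangent field w = d/dt + U. *)
Definition congruence_data : Type :=
  (set 'rV[R]_4 * ('rV[R]_4 -> 'rV[R]_3))%type.
Implicit Type l : congruence_data.

Definition tangent l : 'rV[R]_4 -> 'rV[R]_4 := fun q => event 1 (l.2 q).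

(* Through each point q of B there is an affine null line whose piece through q,
   i.e. the connected component of q in its intersection with B, is everywhere
   tangent to w; this piece is the leaf through q. *)
Definition ray_congruence l : Prop :=
  [/\ open l.1,
      smooth_on l.1 l.2,
      (forall q, l.1 q -> dot (l.2 q) (l.2 q) = 1)
    & (forall q, l.1 q -> exists v, [/\ v != 0, gM v v = 0 &
         forall q', connected_component (l.1 `&` line q v) q q' ->
           exists c : R, tangent l q' = c *: v])].

Definition orthW l q : set 'rV[R]_4 := [set X | gM X (tangent l q) = 0].

Definition screen l q : set 'rV[R]_4 :=
  [set X | [/\ orthW l q X, tcoord X = 0 & dot (spart X) (l.2 q) = 0]].

(* Rotation through +pi/2 on the screen space: (X, Jperp X, U) is positively
   oriented in R^3. *)
Definition Jperp l q X : 'rV[R]_4 := event 0 (cross (l.2 q) (spart X)).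

(* Projection onto the screen space along w; note that tcoord w = 1. *)
Definition screen_proj l q X : 'rV[R]_4 := X - tcoord X *: tangent l q.

Definition shear_free_at l q : Prop := forall X, screen l q X ->
  screen_proj l q (nabla (Jperp l q X) (tangent l) q) =
  Jperp l q (screen_proj l q (nabla X (tangent l) q)).

(* From now on p is a point of Minkowski space and the slice t = t(p) is
   identified with R^3 by means of [event (tcoord p)]. *)
Definition nbhd_of p A (B : set 'rV[R]_4) : Prop :=
  open B /\ event (tcoord p) @` A `<=` B.

Definition ray_congruences_near p A : set congruence_data :=
  [set l | ray_congruence l /\ nbhd_of p A l.1].

Definition shear_free_rays p A : set congruence_data :=
  [set l | ray_congruences_near p A l /\ forall q, l.1 q -> shear_free_at l q].

Definition germ p A l : set congruence_data :=
  [set l' | ray_congruences_near p A l' /\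
    exists B, [/\ nbhd_of p A B, B `<=` l.1 `&` l'.1 & {in B, l.2 =1 l'.2}]].

Definition shear_free_germs p A : set (set congruence_data) :=
  germ p A @` shear_free_rays p A.

Definition projection p A l : 'rV[R]_3 -> 'rV[R]_3 :=
  patch (fun=> 0) A (fun x => l.2 (event (tcoord p) x)).

(* [l] consists of (connected pieces of) the null lines through the points of
   the slice lying in [A] with direction d/dt + U. *)
Definition is_extension p A (U : 'rV[R]_3 -> 'rV[R]_3) l : Prop :=
  ray_congruences_near p A l /\
  forall q, l.1 q -> exists x, [/\ A x,
    connected_component
      (l.1 `&` line (event (tcoord p) x) (event 1 (U x)))
      (event (tcoord p) x) q
    & l.2 q = U x].

(* Both maps on germs choose a representative; independence of the choice has to
   be established separately. *)
Definition germ_projection p A (g : set congruence_data) :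
  'rV[R]_3 -> 'rV[R]_3 := projection p A (get g).

Definition germ_extension p A (U : 'rV[R]_3 -> 'rV[R]_3) :
  set congruence_data := germ p A (get (is_extension p A U)).

End Minkowski.

(* Main.v *)
(** The spatial part U of the tangent field of a ray congruence is constant along
the rays, so near the slice it is determined by its values there: the rays
through a point of space-time hit the slice at x = y - s U, and as U is locally
Lipschitz this equation has at most one small solution; conversely, solving it by
contraction and differentiating implicitly extends any unit field of the slice.

With L = DU on the slice, both conformality and vanishing shear say that L acts
on the screen U^perp as a + b J, J being the rotation by pi/2.  Differentiating
U(t + s, x + s U(x)) = U(t, x) gives N (1 + s L) = L for the derivative N at
parameter s, hence N commutes with J on the screen as soon as L does: vanishing
shear propagates along the rays. *)

Require Import Defs.
From HB Require Import structures.
From mathcomp Require Import all_boot all_order all_algebra.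
From mathcomp Require Import all_classical all_reals all_analysis.
From mathcomp Require Import ring lra.
Import Order.TTheory GRing.Theory Num.Theory numFieldNormedType.Exports.
Local Open Scope classical_set_scope.
Local Open Scope ring_scope.
Set Implicit Arguments.
Unset Strict Implicit.
Unset Printing Implicit Defensive.

(** * Smooth maps between spaces of row vectors *)

Section Differentiability.
Context {R : realType} {V W : normedModType R}.
Implicit Types (f g : V -> W) (x v : V) (L : {linear V -> W}).

(** No smallness is uniform, since [A] is any open set and the Lipschitz constant of [U] may blow up
    towards its boundary. Two congruences are therefore compared near each single point of the
    slice, and the local neighbourhoods are glued by taking an interior; the extension lives on a
    domain whose thickness in time follows a local Lipschitz radius. Vanishing shear, in contrast,
    is needed on the whole domain of an arbitrary extension, where a ray may run far from the slice
    and [1 + s L] is no small perturbation of the identity. There the differentiability of the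
    congruence at the far end replaces smallness: [(1 + s L) X = 0] forces [L X = N 0 = 0], hence
    [X = 0]. The maps on germs go through [get], which returns an uncontrolled representative. This
    is harmless because the values on the slice determine the germ. *)

Lemma diff_approx f x : differentiable f x -> forall e : R, 0 < e ->
  \forall h \near (0 : V), `|f (h + x) - f x - 'd f x h| <= e * `|h|.
Proof.
move=> /diff_locally /eqaddoP fx e e0.
by have := fx e e0; apply: filterS => h; rewrite /= opprD addrA.
Qed.

Lemma approx_diff f x L : continuous L ->
  (forall e : R, 0 < e ->
    \forall h \near (0 : V), `|f (h + x) - f x - L h| <= e * `|h|) ->
  differentiable f x /\ 'd f x = L :> (V -> W).
Proof.
move=> cL H.
have fo : f \o shift x = cst (f x) + L +o_ 0 id.
  apply/eqaddoP => e e0; have := H e e0.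
  by apply: filterS => h; rewrite /= opprD addrA.
have dL := diff_unique cL fo.
by split=> //; apply/diff_locallyP; rewrite dL.
Qed.

Lemma near_eq_differentiable f g x :
  (\near x, f x = g x) -> differentiable f x -> differentiable g x.
Proof.
move=> fg df.
have fgx : f x = g x := nbhs_singleton fg.
have fg0 : \forall h \near (0 : V), f (h + x) = g (h + x).
  by have := fg; rewrite (near_shift 0 x) subr0.
apply: (proj1 (@approx_diff g x ('d f x) _ _)); first exact: diff_continuous.
move=> e e0; have := diff_approx df e0.
apply: filterS2 fg0 => h.
by rewrite fgx => ->.
Qed.

Lemma open_near_eq (A : set V) f g x : open A -> {in A, f =1 g} -> A x ->
  \near x, f x = g x.
Proof.
move=> oA fg Ax; apply: filterS (open_nbhs_nbhs (conj oA Ax)) => y Ay.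
by apply: fg; rewrite inE.
Qed.

End Differentiability.

Lemma derive_comp {R : realType} {U V W : normedModType R}
    (f : U -> V) (g : V -> W) x v :
  differentiable f x -> differentiable g (f x) ->
  'D_v (g \o f) x = 'D_('D_v f x) g (f x).
Proof.
move=> df dg; rewrite (deriveE v (differentiable_comp df dg)).
by rewrite (diff_comp df dg) (deriveE v df) (deriveE _ dg).
Qed.

Section Row.
Context {R : realType} {V : normedModType R}.

Lemma coord_diff m (f : V -> 'rV[R]_m) x v i : differentiable f x ->
  'D_v (fun y => f y 0 i) x = ('D_v f x) 0 i.
Proof.
by move=> df; rewrite derive_mx ?mxE//; exact: diff_derivable.
Qed.

Lemma differentiable_row m (f : V -> 'rV[R]_m) x :
  (forall i, differentiable (fun y => f y 0 i) x) -> differentiable f x.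
Proof.
move=> df.
have -> : f = \sum_(i < m) (fun y => f y 0 i *: delta_mx 0 i).
  apply/funext => y; rewrite fct_sumE.
  by rewrite [LHS]row_sum_delta.
by apply: differentiable_sum => i; exact: differentiableZl.
Qed.

Lemma continuous_row m (f : V -> 'rV[R]_m) x :
  (forall i, {for x, continuous (fun y => f y 0 i)}) -> {for x, continuous f}.
Proof.
move=> cf; apply/cvgrPdist_le => /= e e0.
near=> y.
rewrite [leLHS]/Num.Def.normr/= mx_normrE (bigmax_le _ (ltW e0))//= => i _.
rewrite !mxE ord1; move: i; near: y; apply: filter_forall => /= i.
exact: ((cvgrPdist_le _ _).1 (cf i.2)).
Unshelve. all: by end_near. Qed.

End Row.

Lemma linear_row_continuous {R : realType} {W : normedModType R} m
  (L : {linear 'rV[R]_m -> W}) : continuous L.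
Proof.
move=> x.
have -> : (L : _ -> _) = (fun y => \sum_(i < m) y 0 i *: L (delta_mx 0 i)).
  apply/funext => y; rewrite {1}(row_sum_delta y) linear_sum.
  by apply: eq_bigr => i _; rewrite linearZ.
apply: differentiable_continuous.
rewrite (_ : (fun _ => _) = \sum_(i < m) (fun y : 'rV_m => y 0 i *: L (delta_mx 0 i))).
  apply: differentiable_sum => i.
  exact/differentiableZl/differentiable_coord.
by apply/funext => y; rewrite fct_sumE.
Qed.

Lemma derive_row_sum {R : realType} {W : normedModType R} m
    (f : 'rV[R]_m -> W) x v : differentiable f x ->
  'D_v f x = \sum_(i < m) v 0 i *: 'D_(delta_mx 0 i) f x.
Proof.
move=> df; rewrite deriveE// {1}(row_sum_delta v) linear_sum.
by apply: eq_bigr => i _; rewrite linearZ deriveE.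
Qed.

Section CkCalculus.
Context {R : realType} {V : normedModType R}.
Implicit Types (A : set V) (n : nat).

(** [Ck] differentiates total functions, but rules of calculus are available only at points of [A].
    Openness of [A] lets each derivative be replaced by its formula there, which is how the closure
    lemmas below run their inductions. *)
Lemma Ck_eq {W : normedModType R} n A (f g : V -> W) :
  open A -> {in A, f =1 g} -> Ck n A f -> Ck n A g.
Proof.
move=> oA; elim: n f g => [|n IH] f g fg /=.
  move=> cf x Ax; have fgx := open_near_eq oA fg Ax.
  rewrite /prop_for /continuous_at -(nbhs_singleton fgx).
  apply: cvg_trans (cf x Ax).
  exact: near_eq_cvg.
move=> [df Df]; split=> [x Ax|v].
  exact: near_eq_differentiable (open_near_eq oA fg Ax) (df x Ax).
apply: IH (Df v) => x /[1!inE] Ax.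
exact: near_eq_derive (open_near_eq oA fg Ax).
Qed.

Lemma CkW {W : normedModType R} n A (f : V -> W) : Ck n.+1 A f -> Ck n A f.
Proof.
elim: n f => [|n IH] f [df Df]; last by split=> // v; exact: IH.
by move=> x /df; exact: differentiable_continuous.
Qed.

Lemma Ck_cst {W : normedModType R} n A (a : W) : Ck n A (fun=> a).
Proof.
elim: n a => [|n IH] a /=; first by move=> x _; exact: cst_continuous.
split=> [x _|v]; first exact: differentiable_cst.
have -> : 'D_v (fun=> a) = (fun=> 0) :> (V -> W).
  by apply/funext => x; exact: derive_cst.
exact: IH.
Qed.

Lemma Ck_linear {W : normedModType R} n A (L : {linear V -> W}) :
  continuous L -> Ck n A L.
Proof.
case: n => [|n] cL /=; first by move=> x _; exact: cL.
have dL x : differentiable L x by exact: linear_differentiable.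
split=> // v.
have -> : 'D_v L = (fun=> L v) :> (V -> W).
  by apply/funext => x; rewrite deriveE// diff_lin.
exact: Ck_cst.
Qed.

Lemma CkD {W : normedModType R} n A (f g : V -> W) : open A ->
  Ck n A f -> Ck n A g -> Ck n A (fun x => f x + g x).
Proof.
move=> oA; elim: n f g => [|n IH] f g /=.
  by move=> cf cg x Ax; apply: continuousD; [exact: cf|exact: cg].
move=> [df Df] [dg Dg]; split=> [x Ax|v].
  by apply: differentiableD; [exact: df|exact: dg].
apply: Ck_eq (IH _ _ (Df v) (Dg v)) => // x /[1!inE] Ax.
by rewrite [RHS]deriveD//; apply: diff_derivable; [exact: df|exact: dg].
Qed.

Lemma Ck_sum {W : normedModType R} n A (I : Type) (r : seq I) (P : pred I)
    (F : I -> V -> W) : open A ->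
  (forall i, Ck n A (F i)) -> Ck n A (fun x => \sum_(i <- r | P i) F i x).
Proof.
move=> oA CF; elim: r => [|i r IH].
  by under eq_fun do rewrite big_nil; exact: Ck_cst.
under eq_fun do rewrite big_cons.
by case: (P i) => //; apply: CkD.
Qed.

Lemma CkM n A (f g : V -> R) : open A ->
  Ck n A f -> Ck n A g -> Ck n A (fun x => f x * g x).
Proof.
move=> oA; elim: n f g => [|n IH] f g.
  by move=> cf cg x Ax; apply: continuousM; [exact: cf|exact: cg].
move=> Cf Cg; have [[df Df] [dg Dg]] := (Cf, Cg); split=> [x Ax|v].
  by apply: differentiableM; [exact: df|exact: dg].
apply: Ck_eq (CkD oA (IH _ _ (CkW Cf) (Dg v)) (IH _ _ (CkW Cg) (Df v))) => //.
move=> x /[1!inE] Ax.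
by rewrite [RHS]deriveM//; apply: diff_derivable; [exact: df|exact: dg].
Qed.

Lemma Ck_prod n A (I : Type) (r : seq I) (P : pred I)
    (F : I -> V -> R) : open A ->
  (forall i, Ck n A (F i)) -> Ck n A (fun x => \prod_(i <- r | P i) F i x).
Proof.
move=> oA CF; elim: r => [|i r IH].
  by under eq_fun do rewrite big_nil; exact: Ck_cst.
under eq_fun do rewrite big_cons.
by case: (P i) => //; apply: CkM.
Qed.

Lemma CkV n A (f : V -> R) : open A -> (forall x, A x -> f x != 0) ->
  Ck n A f -> Ck n A (fun x => (f x)^-1).
Proof.
move=> oA f0; elim: n => [|n IH].
  by move=> cf x Ax; apply: continuousV; [exact: f0|exact: cf].
move=> Cf; have [df Df] := Cf; split=> [x Ax|v].
  by apply: differentiableV; [exact: df|exact: f0].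
(* The derivative of [1/f] contains [1/f] again, but one order lower, so the induction closes. *)
have CV := IH (CkW Cf).
have CD : Ck n A (fun x => - 1 * ((f x)^-1 * (f x)^-1) * 'D_v f x).
  apply: (CkM oA) (Df v); apply: (CkM oA); first exact: Ck_cst.
  exact: CkM.
apply: Ck_eq CD => //.
move=> x /[1!inE] Ax.
rewrite [RHS](@deriveV _ _ f)//; [|exact: f0|exact/diff_derivable/df].
by rewrite /GRing.scale/= -exprVn expr2 mulN1r.
Qed.

Lemma Ck_coord m n A (f : V -> 'rV[R]_m) i : open A ->
  Ck n A f -> Ck n A (fun x => f x 0 i).
Proof.
move=> oA; elim: n f => [|n IH] f.
  move=> cf x Ax; apply: (@continuous_comp _ _ _ f (fun y : 'rV_m => y 0 i)).
    exact: cf.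
  exact: coord_continuous.
move=> [df Df]; split=> [x Ax|v].
  apply: (@differentiable_comp _ _ _ _ f (fun y : 'rV_m => y 0 i)); first exact: df.
  exact: differentiable_coord.
apply: Ck_eq (IH _ (Df v)) => // x /[1!inE] Ax.
by rewrite -coord_diff//; exact: df.
Qed.

Lemma Ck_row m n A (f : V -> 'rV[R]_m) : open A ->
  (forall i, Ck n A (fun x => f x 0 i)) -> Ck n A f.
Proof.
move=> oA; elim: n f => [|n IH] f Cf.
  by move=> x Ax; apply: continuous_row => i; exact: Cf.
have df x : A x -> differentiable f x.
  by move=> Ax; apply: differentiable_row => i; exact: (Cf i).1.
split=> // v; apply: IH => i.
apply: Ck_eq ((Cf i).2 v) => // x /[1!inE] Ax.
by rewrite coord_diff//; exact: df.
Qed.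

Lemma CkZ m n A (f : V -> R) (g : V -> 'rV[R]_m) : open A ->
  Ck n A f -> Ck n A g -> Ck n A (fun x => f x *: g x).
Proof.
move=> oA Cf Cg; apply: Ck_row => // i.
by under eq_fun do rewrite mxE; apply: CkM => //; exact: Ck_coord.
Qed.

(** The chain rule differentiates [g] in the direction ['D_v f x], which varies with [x], whereas
    [Ck] only speaks of fixed directions. Expanding along the standard basis repairs this, whence
    row vectors as the domain of [g]. *)
Lemma Ck_comp m k n A (B : set 'rV[R]_m) (f : V -> 'rV[R]_m)
    (g : 'rV[R]_m -> 'rV[R]_k) : open A -> (forall x, A x -> B (f x)) ->
  Ck n A f -> Ck n B g -> Ck n A (fun x => g (f x)).
Proof.
move=> oA AB; elim: n f g AB => [|n IH] f g AB.
  move=> cf cg x Ax; apply: continuous_comp; first exact: cf.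
  exact/cg/AB.
move=> Cf Cg; have [[df Df] [dg Dg]] := (Cf, Cg); split=> [x Ax|v].
  by apply: differentiable_comp; [exact: df|exact/dg/AB].
have CD : Ck n A (fun x => \sum_(i < m)
    ('D_v f x) 0 i *: 'D_(delta_mx 0 i) g (f x)).
  apply: Ck_sum => // i; apply: CkZ => //.
    exact: Ck_coord (Df v).
  by apply: IH (Dg _) => //; exact: CkW.
apply: Ck_eq CD => // x /[1!inE] Ax.
rewrite [RHS](derive_comp _ (df _ Ax) (dg _ (AB _ Ax))).
by rewrite [RHS]derive_row_sum//; exact/dg/AB.
Qed.

End CkCalculus.

(** * Linear algebra of the screen space *)

Section Screen.
Context {R : realType}.
Implicit Types (u v X Y e : 'rV[R]_3).

Lemma dotE u v :
  dot u v = u 0 0 * v 0 0 + u 0 1 * v 0 1 + u 0 2%:R * v 0 2%:R.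
Proof.
rewrite /dot !big_ord_recl big_ord0 addr0 addrA.
by congr (_ + _ * _ + _ * _); congr (_ 0 _); apply/val_inj.
Qed.

Lemma row3P u v : u 0 0 = v 0 0 -> u 0 1 = v 0 1 -> u 0 2%:R = v 0 2%:R -> u = v.
Proof.
move=> e0 e1 e2; apply/rowP => -[[|[|[|//]]] i3].
- by rewrite (_ : Ordinal i3 = 0)//; apply/val_inj.
- by rewrite (_ : Ordinal i3 = 1)//; apply/val_inj.
- by rewrite (_ : Ordinal i3 = 2%:R)//; apply/val_inj.
Qed.

Lemma cross0 u v : cross u v 0 0 = u 0 1 * v 0 2%:R - u 0 2%:R * v 0 1.
Proof.
by rewrite mxE; congr (u 0 _ * v 0 _ - u 0 _ * v 0 _); apply/val_inj.
Qed.

Lemma cross1 u v : cross u v 0 1 = u 0 2%:R * v 0 0 - u 0 0 * v 0 2%:R.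
Proof.
by rewrite mxE; congr (u 0 _ * v 0 _ - u 0 _ * v 0 _); apply/val_inj.
Qed.

Lemma cross2 u v : cross u v 0 2%:R = u 0 0 * v 0 1 - u 0 1 * v 0 0.
Proof.
by rewrite mxE; congr (u 0 _ * v 0 _ - u 0 _ * v 0 _); apply/val_inj.
Qed.

Lemma rowD_coord u v i : (u + v) 0 i = u 0 i + v 0 i. Proof. by rewrite mxE. Qed.

Lemma rowZ_coord (a : R) u i : (a *: u) 0 i = a * u 0 i. Proof. by rewrite mxE. Qed.

Let coordE := (rowD_coord, rowZ_coord, cross0, cross1, cross2, dotE).

Lemma dotC u v : dot u v = dot v u. Proof. by rewrite !coordE; ring. Qed.

Lemma dotDl u v X : dot (u + v) X = dot u X + dot v X.
Proof. by rewrite !coordE; ring. Qed.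

Lemma dotZl (a : R) u v : dot (a *: u) v = a * dot u v.
Proof. by rewrite !coordE; ring. Qed.

Lemma dotDr u v X : dot X (u + v) = dot X u + dot X v.
Proof. by rewrite dotC dotDl !(dotC X). Qed.

Lemma dotZr (a : R) u v : dot u (a *: v) = a * dot u v.
Proof. by rewrite dotC dotZl dotC. Qed.

Lemma crossD u X Y : cross u (X + Y) = cross u X + cross u Y.
Proof. by apply: row3P; rewrite !coordE; ring. Qed.

Lemma crossZ (a : R) u X : cross u (a *: X) = a *: cross u X.
Proof. by apply: row3P; rewrite !coordE; ring. Qed.

Lemma dot_cross u X : dot (cross u X) u = 0.
Proof. by rewrite !coordE; ring. Qed.

Lemma cross_skew u X Y : dot (cross u X) Y = - dot X (cross u Y).
Proof. by rewrite !coordE; ring. Qed.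

Lemma cross_cross u X : cross u (cross u X) = dot X u *: u + (- dot u u) *: X.
Proof. by apply: row3P; rewrite !coordE; ring. Qed.

Lemma dot_self_eq0 u : dot u u = 0 -> u = 0.
Proof.
rewrite !coordE => u0; apply: row3P; rewrite mxE; nra.
Qed.

Variable u : 'rV[R]_3.
Hypothesis u1 : dot u u = 1.

Lemma cross_crossN X : dot X u = 0 -> cross u (cross u X) = (-1) *: X.
Proof. by move=> Xu; rewrite cross_cross Xu u1 scale0r add0r. Qed.

Lemma dot_cross_cross X Y : dot X u = 0 ->
  dot (cross u X) (cross u Y) = dot X Y.
Proof.
by move=> Xu; rewrite dotC cross_skew cross_crossN// dotZr mulN1r opprK dotC.
Qed.

Lemma dot_cross_self X : dot X (cross u X) = 0.
Proof. by rewrite !coordE; ring. Qed.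

Lemma screen_decomp e X : dot e u = 0 -> dot X u = 0 ->
  dot e e *: X = dot X e *: e + dot X (cross u e) *: cross u e.
Proof.
move=> eu Xu.
(* det(a,b,c) X = (X.a) b x c + (X.b) c x a + (X.c) a x b for the triple
   (a, b, c) = (u, e, u x e). *)
have : dot (cross u e) (cross u e) *: X =
  dot X u *: cross e (cross u e) + dot X e *: cross (cross u e) u +
  dot X (cross u e) *: cross u e.
  by apply: row3P; rewrite !coordE; ring.
rewrite dot_cross_cross// Xu scale0r add0r => ->; congr (_ *: _ + _).
transitivity (dot u u *: e + (- dot e u) *: u).
  by apply: row3P; rewrite !coordE; ring.
by rewrite u1 eu oppr0 scale0r addr0 scale1r.
Qed.

(** The vector is not normalized, which avoids square roots; the factors [dot e e] below are the
    price. *)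
Lemma screen_basis : exists2 e, e != 0 & dot e u = 0.
Proof.
pose E : 'I_3 -> 'rV[R]_3 := fun i => cross u (delta_mx 0 i).
have [/existsP[i Ei]|] := boolP [exists i, E i != 0].
  by exists (E i) => //; exact: dot_cross.
rewrite negb_exists => /forallP /= E0; exfalso.
have Z i j : cross u (delta_mx 0 i) 0 j = 0.
  by move/negPn/eqP: (E0 i); rewrite /E => ->; rewrite mxE.
(* Up to sign, the entries of [cross u (delta_mx 0 i)] are the coordinates of [u], so all of these
   vanish, against [u1]. *)
move: (Z 0 1) (Z 0 2%:R) (Z 1 0) (Z 1 2%:R) u1; rewrite !coordE !mxE /=.
rewrite !(mulr0, mulr1, subr0, sub0r, addr0, add0r).
move=> a b c d; nra.
Qed.

Section Operator.
Variable L : {linear 'rV[R]_3 -> 'rV[R]_3}.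
Hypothesis Lu : forall X, dot (L X) u = 0.

(** Multiplication by the complex number [a + i b], if [cross u] is taken as multiplication by [i]
    on the screen. *)
Definition screen_scalar :=
  exists a b : R, forall X, dot X u = 0 -> L X = a *: X + b *: cross u X.

Lemma screen_scalarP e a b : e != 0 -> dot e u = 0 ->
  L e = a *: e + b *: cross u e ->
  L (cross u e) = (- b) *: e + a *: cross u e -> screen_scalar.
Proof.
move=> e0 eu Le Lf; exists a, b => X Xu.
have ee0 : dot e e != 0 by apply: contra_neq e0; exact: dot_self_eq0.
have -> : X = (dot e e)^-1 *: (dot X e *: e + dot X (cross u e) *: cross u e).
  by rewrite -screen_decomp// scalerA mulVf// scale1r.
set x := dot X e; set y := dot X _.
rewrite linearZ linearD !linearZ Le Lf !(crossZ, crossD) cross_crossN//.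
by apply: row3P; rewrite !(rowD_coord, rowZ_coord); ring.
Qed.

Lemma screen_scalar_of_commute :
  (forall X, dot X u = 0 -> L (cross u X) = cross u (L X)) -> screen_scalar.
Proof.
move=> LJ; have [e e0 eu] := screen_basis.
have ee0 : dot e e != 0 by apply: contra_neq e0; exact: dot_self_eq0.
pose a := (dot e e)^-1 * dot (L e) e.
pose b := (dot e e)^-1 * dot (L e) (cross u e).
have Le : L e = a *: e + b *: cross u e.
  by rewrite -!scalerA -scalerDr -screen_decomp// scalerA mulVf// scale1r.
apply: (screen_scalarP e0 eu Le).
rewrite LJ// Le crossD !crossZ cross_crossN//.
by apply: row3P; rewrite !(rowD_coord, rowZ_coord); ring.
Qed.

Lemma commute_of_screen_scalar : screen_scalar ->
  forall X, dot X u = 0 -> L (cross u X) = cross u (L X).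
Proof.
move=> [a [b Lab]] X Xu.
by rewrite !Lab ?dot_cross// crossD !crossZ.
Qed.

(** In the orthogonal frame [e], [f = cross u e], whose members have equal length, the three
    products [ee], [ff], [ef] say that the matrix of [L] has equal diagonal and opposite
    off-diagonal entries. *)
Lemma screen_scalar_of_conformal (nu : R) :
  (forall X Y, dot X u = 0 -> dot Y u = 0 ->
    dot (L X) Y + dot X (L Y) = nu * dot X Y) -> screen_scalar.
Proof.
move=> Lnu; have [e e0 eu] := screen_basis.
have ee0 : dot e e != 0 by apply: contra_neq e0; exact: dot_self_eq0.
pose f := cross u e.
have fu : dot f u = 0 by exact: dot_cross.
have decomp X : dot X u = 0 ->
    X = ((dot e e)^-1 * dot X e) *: e + ((dot e e)^-1 * dot X f) *: f.
  by move=> Xu; rewrite -!scalerA -scalerDr -screen_decomp// scalerA mulVf// scale1r.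
have := Lnu e e eu eu; rewrite (dotC e (L e)) => ee.
have := Lnu f f fu fu; rewrite (dotC f (L f)) dot_cross_cross// => ff.
have := Lnu e f eu fu; rewrite dot_cross_self mulr0 (dotC e) => ef.
apply: (screen_scalarP e0 eu (decomp _ (Lu e))).
rewrite {1}(decomp _ (Lu f)) -mulrN; congr (_ * _ *: _ + _ * _ *: _); lra.
Qed.

(** The rotation is skew, so only [a] survives symmetrization, twice. *)
Lemma conformal_of_screen_scalar : screen_scalar -> exists nu : R,
  forall X Y, dot X u = 0 -> dot Y u = 0 ->
    dot (L X) Y + dot X (L Y) = nu * dot X Y.
Proof.
move=> [a [b Lab]]; exists (2 * a) => X Y Xu Yu.
rewrite !Lab// dotDl dotDr !(dotZl, dotZr) cross_skew; ring.
Qed.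

(* [N] is the value of [L] transported by the flow [1 + s L]; the hypothesis
   makes [1 + s L] injective on the screen, hence invertible there. *)
Lemma screen_scalar_transport (N : {linear 'rV[R]_3 -> 'rV[R]_3}) (s : R) :
  (forall X, dot X u = 0 -> N (X + s *: L X) = L X) ->
  screen_scalar ->
  forall Y, dot Y u = 0 -> N (cross u Y) = cross u (N Y).
Proof.
move=> NL sL; have [a [b Lab]] := sL; have LJ := commute_of_screen_scalar sL.
pose c := 1 + s * a; pose d := s * b.
have ILE X : dot X u = 0 -> X + s *: L X = c *: X + d *: cross u X.
  move=> Xu; rewrite Lab//.
  by apply: row3P; rewrite !(rowD_coord, rowZ_coord) /c /d; ring.
(* [c ^+ 2 + d ^+ 2] is the determinant of [1 + s L] on the screen. If it vanishes then [1 + s L] is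
   zero there, so [L Y = N 0 = 0] and [Y = Y + s *: L Y = 0]. *)
have [cd0 Y Yu|cd0 Y Yu] := eqVneq (c ^+ 2 + d ^+ 2) 0.
  have [c0 d0] : c = 0 /\ d = 0 by split; nra.
  have Y0 : Y = 0.
    have := NL Y Yu; rewrite ILE// c0 d0 !scale0r addr0 linear0 => L0.
    have := ILE Y Yu; rewrite c0 d0 !scale0r addr0 -L0 scaler0 addr0.
    by [].
  rewrite Y0 linear0 (_ : cross u 0 = 0) ?linear0//.
  by apply: row3P; rewrite !coordE !mxE; ring.
(* The inverse of [c + d J] is its conjugate [c - d J] divided by the determinant. *)
pose X := (c ^+ 2 + d ^+ 2)^-1 *: (c *: Y + (- d) *: cross u Y).
have Xu : dot X u = 0.
  by rewrite dotZl dotDl !dotZl Yu dot_cross; ring.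
have Juu : dot (cross u X) u = 0 by exact: dot_cross.
have XY : X + s *: L X = Y.
  rewrite ILE// /X !(crossZ, crossD) cross_crossN//.
  by apply: row3P; rewrite !(rowD_coord, rowZ_coord); field.
have -> : cross u Y = cross u X + s *: L (cross u X).
  by rewrite LJ// -crossZ -crossD XY.
by rewrite NL// LJ// -XY NL.
Qed.

End Operator.
End Screen.

(** * Sup-norm estimates and the local Lipschitz bound *)

Section RowNorm.
Context {R : realType} {m : nat}.
Implicit Types (v : 'rV[R]_m).

Lemma coord_le_norm v i : `|v 0 i| <= `|v|.
Proof.
rewrite [leRHS]/Num.Def.normr/= mx_normrE.
exact: (le_bigmax _ (fun ij => `|v ij.1 ij.2|) (0, i)).
Qed.

Lemma row_norm_le v (e : R) : 0 <= e -> (forall i, `|v 0 i| <= e) -> `|v| <= e.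
Proof.
move=> e0 ve; rewrite [leLHS]/Num.Def.normr/= mx_normrE.
by apply: (bigmax_le _ e0) => -[i j] _ /=; rewrite ord1.
Qed.

End RowNorm.

Lemma nbhs_norm_ball {R : realType} {V : normedModType R} (x : V) (P : set V) :
  nbhs x P <-> exists2 r : R, 0 < r & forall y, `|y - x| < r -> P y.
Proof.
split=> [/nbhs_ballP[r r0 rP]|[r r0 rP]].
  exists r => // y yx; apply: rP.
  by rewrite -ball_normE /ball_/= distrC.
apply/nbhs_ballP; exists r => // y; rewrite -ball_normE /ball_/= distrC.
exact: rP.
Qed.

Lemma segment_in_ball {R : realType} {V : normedModType R} (c a b : V) (r t : R) :
  `|a - c| < r -> `|b - c| < r -> 0 <= t <= 1 -> `|b + t *: (a - b) - c| < r.
Proof.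
move=> ac bc /andP[t0 t1].
have -> : b + t *: (a - b) - c = t *: (a - c) + (1 - t) *: (b - c).
  by rewrite scalerBl scale1r addrCA -scalerBr opprB addrA subrK addrAC.
apply: (le_lt_trans (ler_normD _ _)); rewrite !normrZ !ger0_norm ?subr_ge0//.
have [->|t0'] := eqVneq t 0; first by rewrite mul0r add0r subr0 mul1r.
have tp : 0 < t by rewrite lt_neqAle eq_sym t0'.
have : t * `|a - c| < t * r by rewrite ltr_pM2l.
have : (1 - t) * `|b - c| <= (1 - t) * r by rewrite ler_wpM2l ?subr_ge0// ltW.
lra.
Qed.

Section Line.
Context {R : realType} {V W : normedModType R}.

Lemma is_diff_line (a v : V) (t : R) :
  differentiable (fun s : R => a + s *: v) t /\
  'D_1 (fun s : R => a + s *: v) t = v.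
Proof.
have dv : differentiable (fun s : R => s *: v) t.
  exact: (@differentiableZl _ _ _ id).
split.
  by apply: (@differentiableD _ _ _ (cst a) (fun s : R => s *: v)) => //; exact: differentiable_cst.
rewrite (@deriveD _ _ _ (cst a) (fun s : R => s *: v)); last 2 first.
- exact: derivable_cst.
- exact: diff_derivable.
rewrite derive_cst add0r deriveE//.
by have := is_diff_scalel t v => ?; rewrite diff_val scale1r.
Qed.

End Line.

(** Continuous partial derivatives stay within 1 of their value at [x] on a small ball. The mean
    value theorem is applied to one coordinate at a time, as it fails for vector values; the sup
    norm reassembles them. *)
Lemma Ck1_lipschitz_near {R : realType} m k (A : set 'rV[R]_m)
    (f : 'rV[R]_m -> 'rV[R]_k) x : open A -> Ck 1 A f -> A x ->
  exists K r : R, [/\ 0 < K, 0 < r, (forall y, `|y - x| < r -> A y) &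
    forall a b, `|a - x| < r -> `|b - x| < r -> `|f a - f b| <= K * `|a - b|].
Proof.
move=> oA [df Df] Ax.
pose M j := `|'D_(delta_mx 0 j) f x| + 1.
have nM : \forall y \near x, forall j, `|'D_(delta_mx 0 j) f y| <= M j.
  suff nj j : \forall y \near x, `|'D_(delta_mx 0 j) f y| <= M j.
    have := @filter_forall _ _ (fun j y => `|'D_(delta_mx 0 j) f y| <= M j) _ _ nj.
    exact.
  have : \forall y \near x, `|'D_(delta_mx 0 j) f x - 'D_(delta_mx 0 j) f y| <= 1.
    exact: (cvgrPdist_le _ _).1 (Df (delta_mx 0 j) x Ax) 1 ltr01.
  apply: filterS => y; rewrite distrC => yx.
  rewrite -[X in `|X|](subrK ('D_(delta_mx 0 j) f x)) /M addrC.
  by rewrite (le_trans (ler_normD _ _))// lerD2l.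
have nA : nbhs x A by exact: open_nbhs_nbhs.
have [r r0 rP] := (nbhs_norm_ball _ _).1 (filterI nA nM).
(* The summand 1 makes [K] positive even when [m = 0]. *)
pose K := \sum_j M j + 1.
have M0 j : 0 <= M j by rewrite addr_ge0.
have K0 : 0 < K by rewrite ltr_wpDl// sumr_ge0.
exists K, r; split=> // [y /rP[]//|a b ax bx].
apply: row_norm_le => [|i]; first by rewrite mulr_ge0// ltW.
pose g (t : R) := f (b + t *: (a - b)) 0 i.
have gd (t : R) : 0 <= t <= 1 -> is_derive t 1 g (('D_(a - b) f (b + t *: (a - b))) 0 i).
  move=> t01; have [At _] := rP _ (segment_in_ball ax bx t01).
  have [dl Dl] := is_diff_line b (a - b) t.
  have dfl : differentiable (f \o (fun t : R => b + t *: (a - b))) t.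
    by apply: differentiable_comp => //; exact: df.
  apply: DeriveDef.
    apply: diff_derivable.
    apply: (@differentiable_comp _ _ _ _ (f \o (fun t : R => b + t *: (a - b))) (fun y : 'rV_k => y 0 i)) => //.
    exact: differentiable_coord.
  rewrite /g (coord_diff _ _ dfl) (derive_comp _ dl (df _ At)).
  by rewrite Dl.
have [||c c01] := @MVT_segment R g (fun t => ('D_(a - b) f (b + t *: (a - b))) 0 i) 0 1 ler01.
- by move=> t; rewrite in_itv/= => /andP[t0 t1]; apply: gd; rewrite !ltW.
- apply: derivable_within_continuous => t; rewrite in_itv/= => t01.
  by have [] := gd t t01.
rewrite subr0 mulr1 /g scale1r subrKC scale0r addr0 !mxE => ->.
have c01' : 0 <= c <= 1 by move: c01; rewrite in_itv.
have [Ac Mc] := rP _ (segment_in_ball ax bx c01').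
rewrite derive_row_sum; last exact: df.
rewrite summxE (le_trans (ler_norm_sum _ _ _))//.
rewrite /K mulrDl mul1r ler_wpDr// mulr_suml ler_sum// => j _.
rewrite mxE normrM mulrC ler_pM//; last exact: coord_le_norm.
by rewrite (le_trans (coord_le_norm _ _))//; exact: Mc.
Qed.

(** * Rays and shear *)

Section Events.
Context {R : realType}.
Implicit Types (q h : 'rV[R]_4) (x y v : 'rV[R]_3) (s t : R).

Lemma tcoord_event t x : tcoord (event t x) = t.
Proof.
transitivity (row_mx (t%:M : 'rV[R]_1) x 0 (lshift 3 0)).
  by congr (fun_of_matrix _ _ _); exact/val_inj.
by rewrite row_mxEl mxE eqxx.
Qed.

Lemma spart_event t x : spart (event t x) = x.
Proof. by rewrite /spart row_mxKr. Qed.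

Lemma event_coords q : event (tcoord q) (spart q) = q.
Proof.
rewrite /event /spart.
have -> : ((tcoord q)%:M : 'rV[R]_1) = lsubmx (q : 'rV[R]_(1 + 3)).
  apply/rowP => i; rewrite (ord1 i) !mxE eqxx /tcoord.
  by congr (fun_of_matrix _ _ _); exact/val_inj.
exact: (@hsubmxK _ 1 1 3).
Qed.

Lemma event_eq q q' : tcoord q = tcoord q' -> spart q = spart q' -> q = q'.
Proof. by move=> tq sq; rewrite -(event_coords q) tq sq event_coords. Qed.

Lemma event_inj t t' x x' : event t x = event t' x' -> t = t' /\ x = x'.
Proof.
by move=> /[dup] /(congr1 tcoord) + /(congr1 spart); rewrite !tcoord_event !spart_event.
Qed.

Lemma tcoord_is_linear : linear (tcoord : 'rV[R]_4 -> R).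
Proof. by move=> a u v; rewrite /tcoord !mxE. Qed.

Lemma spart_is_linear : linear (spart : 'rV[R]_4 -> 'rV[R]_3).
Proof. by move=> a u v; rewrite /spart linearP. Qed.

HB.instance Definition _ := GRing.isLinear.Build R 'rV[R]_4 R _ tcoord tcoord_is_linear.
HB.instance Definition _ := GRing.isLinear.Build R 'rV[R]_4 'rV[R]_3 _ spart spart_is_linear.

Lemma eventD s t x y : event s x + event t y = event (s + t) (x + y).
Proof. by apply: event_eq; rewrite linearD/= !(tcoord_event, spart_event). Qed.

Lemma eventZ s t x : s *: event t x = event (s * t) (s *: x).
Proof. by apply: event_eq; rewrite linearZ/= !(tcoord_event, spart_event). Qed.

Lemma event0_is_linear : linear (@event R 0).
Proof. by move=> a x y; rewrite eventZ eventD mulr0 addr0. Qed.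

HB.instance Definition _ := GRing.isLinear.Build R 'rV[R]_3 'rV[R]_4 _ (event 0) event0_is_linear.

Lemma event_ray t x s v : event t x + s *: event 1 v = event (t + s) (x + s *: v).
Proof. by rewrite eventZ eventD mulr1. Qed.

Lemma eventE t x : event t x = event t 0 + event 0 x.
Proof. by rewrite eventD addr0 add0r. Qed.

Lemma tcoord_norm q : `|tcoord q| <= `|q|. Proof. exact: coord_le_norm. Qed.

Lemma spart_norm q : `|spart q| <= `|q|.
Proof.
apply: row_norm_le => // i; rewrite mxE.
exact: (coord_le_norm q).
Qed.

Lemma continuous_tcoord : continuous (tcoord : 'rV[R]_4 -> R).
Proof. exact: (@linear_row_continuous _ _ _ tcoord). Qed.

Lemma continuous_event t : continuous (@event R t).
Proof.
move=> x; rewrite (_ : event t = (fun y => cst (event t 0) y + event 0 y)).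
  by apply: continuousD; [exact: cst_continuous|exact: (@linear_row_continuous _ _ _ (event 0))].
by apply/funext => y; rewrite eventE.
Qed.

Lemma Ck_event n t (A : set 'rV[R]_3) : open A -> Ck n A (event t).
Proof.
move=> oA; have /= C0 := Ck_linear n A (@linear_row_continuous _ _ _ (@event R 0)).
have := CkD oA (Ck_cst n A (event t 0)) C0.
by apply: Ck_eq => // x _; rewrite -eventE.
Qed.

Lemma is_diff_event t x X :
  differentiable (event t) x /\ 'D_X (event t) x = event 0 X.
Proof.
have [//|dx _] := @Ck_event 1 t setT; first exact: openT.
split; first exact: dx.
rewrite (_ : event t = cst (event t 0) + event 0); last first.
  by apply/funext => y; rewrite eventE.
have d0 : differentiable (event 0) x.
  exact: (@linear_differentiable _ _ _ (event 0) x (@linear_row_continuous _ _ _ (event 0))).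
rewrite deriveD; [|exact: derivable_cst|exact: diff_derivable].
rewrite derive_cst add0r deriveE// (@diff_lin _ _ _ (event 0))//.
exact: linear_row_continuous.
Qed.

End Events.

Section Segments.
Context {R : realType}.
Implicit Types (q v : 'rV[R]_4) (B : set 'rV[R]_4).

Lemma segment_component {V : normedModType R} (S : set V) (a v : V) :
  (forall t : R, 0 <= t <= 1 -> S (a + t *: v)) ->
  connected_component S a (a + v).
Proof.
move=> Sv; pose C := (fun t : R => a + t *: v) @` `[0, 1].
apply: (@connected_component_max _ S C).
- by exists 0; rewrite ?scale0r ?addr0//= in_itv/= lexx ler01.
- by move=> _ [t /= + <-]; rewrite in_itv/= => /Sv.
- apply: connected_continuous_connected; first exact: segment_connected.
  apply: continuous_subspaceT => t; apply: differentiable_continuous.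
  exact: (is_diff_line a v t).1.
- by exists 1; rewrite ?scale1r//= in_itv/= lexx ler01.
Qed.

Lemma component_segment B q v (s : R) : tcoord v = 1 ->
  connected_component (B `&` line q v) q (q + s *: v) ->
  forall t : R, 0 <= t <= 1 -> B (q + (t * s) *: v).
Proof.
move=> v1 [C [Cq CB Cc] Cs] t /andP[t0 t1].
have /connected_intervalP Ci : connected (tcoord @` C).
  apply: connected_continuous_connected => //.
  by apply: continuous_subspaceT; exact: continuous_tcoord.
have tcE r : tcoord (q + r *: v) = tcoord q + r.
  by rewrite linearD linearZ/= v1; rewrite /GRing.scale/= mulr1.
suff [q' Cq' tq'] : (tcoord @` C) (tcoord q + t * s).
  have [Bq' [r _ rq']] := CB _ Cq'.
  by move: tq'; rewrite -rq' tcE => /addrI <-; rewrite rq'.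
have C0 : (tcoord @` C) (tcoord q) by exists q.
have C1 : (tcoord @` C) (tcoord q + s) by exists (q + s *: v).
have [s0|s0] := leP 0 s.
  by apply: (Ci _ _ C0 C1); nra.
by apply: (Ci _ _ C1 C0); nra.
Qed.

(** The leaf direction [v] is known only up to scale. Both end tangents are multiples of it with
    time component 1, so they coincide. *)
Lemma ray_tangent_const (l : @congruence_data R) q (s : R) :
  ray_congruence l -> l.1 q ->
  (forall t : R, 0 <= t <= 1 -> l.1 (q + (t * s) *: tangent l q)) ->
  l.2 (q + s *: tangent l q) = l.2 q.
Proof.
move=> [_ _ _ lray] lq lseg.
have [v [v0 _ vq]] := lray _ lq.
set w := tangent l q in lseg *.
have [c qc] : exists c, w = c *: v.
  apply: vq; apply: connected_component_refl; split => //.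
  by exists 0; rewrite ?scale0r ?addr0.
have w1 : tcoord w = 1 by rewrite tcoord_event.
have c0 : c != 0.
  by apply: contra_eq_neq w1 => c0; rewrite qc c0 scale0r linear0 eq_sym oner_eq0.
have wv r : line q v (q + r *: w).
  by exists (r * c) => //; rewrite qc scalerA.
have [c' qc'] : exists c', tangent l (q + s *: w) = c' *: v.
  apply: vq; apply: segment_component => t t01; rewrite scalerA; split=> //.
  exact: lseg.
have vE : v = c^-1 *: w by rewrite qc scalerA mulVf// scale1r.
move: qc'; rewrite vE scalerA /tangent => qc'.
have := congr1 tcoord qc'; rewrite linearZ/= !tcoord_event [RHS]mulr1 => c'1.
by move: qc'; rewrite -c'1 scale1r => /event_inj[].
Qed.

End Segments.

Section Unit.
Context {R : realType}.

(** Links the geometry, measured by [dot], to the sup norm used in all estimates. *)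
Lemma unit_norm_le1 (u : 'rV[R]_3) : dot u u = 1 -> `|u| <= 1.
Proof.
move=> u1; apply: row_norm_le => // i.
have : u 0 i ^+ 2 <= 1.
  rewrite -u1 /dot (bigD1 i)//= expr2 lerDl sumr_ge0// => j _.
  by rewrite -expr2 sqr_ge0.
by rewrite -real_normK ?num_real// expr_le1.
Qed.

Lemma event_unit_norm_le1 (u : 'rV[R]_3) : dot u u = 1 -> `|event 1 u| <= 1.
Proof.
move=> /unit_norm_le1 u1; apply: row_norm_le => // i.
rewrite /event mxE; case: (@splitP 1 3 i) => j _.
  by rewrite mxE (ord1 j) eqxx normr1.
exact: le_trans (coord_le_norm _ _) u1.
Qed.

(** Differentiating [dot f f = 1] shows that the derivative of a unit field takes its values in the
    screen, as hypothesis [Lu] demands. *)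
Lemma derive_dot_unit {V : normedModType R} (A : set V) (f : V -> 'rV[R]_3) x v :
  open A -> A x -> differentiable f x -> (forall y, A y -> dot (f y) (f y) = 1) ->
  dot ('D_v f x) (f x) = 0.
Proof.
move=> oA Ax df f1.
have D0 : 'D_v (fun y => dot (f y) (f y)) x = 0.
  rewrite -(derive_cst (1 : R) x v); apply: near_eq_derive.
  by apply: (open_near_eq oA) => // y /[1!inE] /f1.
have dfi i : derivable (fun y => f y 0 i) x v.
  apply: diff_derivable.
  apply: (@differentiable_comp _ _ _ _ f (fun y : 'rV_3 => y 0 i)) => //.
  exact: differentiable_coord.
have : 'D_v (fun y => dot (f y) (f y)) x = 2 * dot ('D_v f x) (f x).
  rewrite (_ : (fun y => _) = \sum_(i < 3) ((fun y => f y 0 i) * (fun y => f y 0 i))); last first.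
    by apply/funext => y; rewrite fct_sumE.
  rewrite derive_sum; last by move=> i; exact: derivableM.
  rewrite /dot mulr_sumr; apply: eq_bigr => i _.
  rewrite deriveM// (coord_diff _ _ df) /GRing.scale/=; ring.
rewrite D0 => /esym/eqP; rewrite mulf_eq0 pnatr_eq0/= => /eqP//.
Qed.

End Unit.

Section ConformalScreen.
Context {R : realType}.
Implicit Types (A : set 'rV[R]_3) (U : 'rV[R]_3 -> 'rV[R]_3).

Lemma lie_derive_euclidean U x X Y :
  lie_derive U euclidean_metric x X Y = dot ('D_X U x) Y + dot X ('D_Y U x).
Proof. by rewrite /lie_derive /euclidean_metric derive_cst add0r. Qed.

(** The Lie derivative of the constant metric is the symmetrized derivative of [U], so the criterion
    reduces to linear algebra at each point. *)
Lemma conformalP A U : open A -> (forall x, A x -> differentiable U x) ->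
  (forall x, A x -> dot (U x) (U x) = 1) ->
  conformal A U <-> (forall x, A x -> screen_scalar (U x) ('d U x)).
Proof.
move=> oA dU U1.
have dot0 x : A x -> forall X, dot ('d U x X) (U x) = 0.
  by move=> Ax X; rewrite -(deriveE _ (dU _ Ax)); exact: (derive_dot_unit _ oA Ax (dU _ Ax) U1).
split=> [[nu Hnu] x Ax|Hs].
  apply: (screen_scalar_of_conformal (U1 _ Ax) (dot0 _ Ax) (nu := nu x)) => X Y Xu Yu.
  by rewrite -!deriveE; [rewrite -lie_derive_euclidean; exact: Hnu|exact: dU..].
have /choice[nu Hnu] : forall x, exists nu : R, A x -> forall X Y,
    dot X (U x) = 0 -> dot Y (U x) = 0 ->
    dot ('d U x X) Y + dot X ('d U x Y) = nu * dot X Y.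
  move=> x; have [Ax|nAx] := pselect (A x); last by exists 0.
  by have [nu Hnu] := conformal_of_screen_scalar (Hs _ Ax); exists nu.
exists nu => x Ax X Y Xu Yu.
by rewrite lie_derive_euclidean !deriveE; [exact: Hnu|exact: dU..].
Qed.

End ConformalScreen.

Section Rays.
Context {R : realType}.
Implicit Types (l : @congruence_data R) (p q : 'rV[R]_4) (A : set 'rV[R]_3).

(** The time component of the tangent field is constantly 1, so its derivatives are spatial and
    [screen_proj] fixes them. A spatial vector orthogonal to [U] is automatically orthogonal to the
    tangent. *)
Lemma shear_free_atP l q : differentiable l.2 q ->
  shear_free_at l q <-> (forall X, dot X (l.2 q) = 0 ->
    'D_(event 0 (cross (l.2 q) X)) l.2 q =
    cross (l.2 q) ('D_(event 0 X) l.2 q)).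
Proof.
move=> dl.
have DT Y : nabla Y (tangent l) q = event 0 ('D_Y l.2 q).
  have [de De] := is_diff_event 1 (l.2 q) ('D_Y l.2 q).
  by rewrite -De /nabla -(derive_comp _ dl de).
have SP Z : screen_proj l q (event 0 Z) = event 0 Z.
  by rewrite /screen_proj tcoord_event scale0r subr0.
have JE Z : Jperp l q (event 0 Z) = event 0 (cross (l.2 q) Z).
  by rewrite /Jperp spart_event.
have sfE X : screen_proj l q (nabla (Jperp l q (event 0 X)) (tangent l) q) =
    event 0 ('D_(event 0 (cross (l.2 q) X)) l.2 q).
  by rewrite JE DT SP.
have sfE' X : Jperp l q (screen_proj l q (nabla (event 0 X) (tangent l) q)) =
    event 0 (cross (l.2 q) ('D_(event 0 X) l.2 q)).
  by rewrite DT SP JE.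
split=> [H X Xu|H X [_ X0 Xu]].
  suff /H : screen l q (event 0 X).
    by move=> sfX; have /event_inj[] := etrans (esym (sfE X)) (etrans sfX (sfE' X)).
  split; rewrite ?tcoord_event ?spart_event//.
  by rewrite /orthW/= /gM !tcoord_event !spart_event mul0r oppr0 add0r.
rewrite -(event_coords X) X0; apply: etrans (sfE _) _.
by rewrite H//; exact/esym/sfE'.
Qed.

Lemma slice_smooth l p A : ray_congruences_near p A l -> open A ->
  smooth_on A (fun x => l.2 (event (tcoord p) x)).
Proof.
move=> [[_ sl _ _] [_ Al]] oA n.
apply: (Ck_comp oA _ (Ck_event n _ oA) (sl n)).
by move=> x Ax; apply: Al; exists x.
Qed.

Lemma slice_derive l t x X : differentiable l.2 (event t x) ->
  'D_X (fun y => l.2 (event t y)) x = 'D_(event 0 X) l.2 (event t x).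
Proof.
move=> dl; have [de De] := is_diff_event t x X.
by rewrite (derive_comp X de dl) De.
Qed.

Lemma projectionE p A l x : A x -> projection p A l x = l.2 (event (tcoord p) x).
Proof. by move=> Ax; rewrite /projection patchT// inE. Qed.

Lemma projection_out p A l x : ~ A x -> projection p A l x = 0.
Proof. by move=> nAx; rewrite /projection /patch memNset. Qed.

Lemma projection_conformal p A l : open A -> shear_free_rays p A l ->
  conformal_foliations A (projection p A l).
Proof.
move=> oA [lA lsf].
have [[ol sl l1 _] [_ Al]] := lA.
have lx x : A x -> l.1 (event (tcoord p) x) by move=> Ax; apply: Al; exists x.
have sP : smooth_on A (projection p A l).
  move=> n; apply: Ck_eq (slice_smooth lA oA n) => // x /[1!inE] Ax.
  by rewrite projectionE.
have P1 x : A x -> dot (projection p A l x) (projection p A l x) = 1.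
  by move=> Ax; rewrite projectionE// l1//; exact: lx.
split; first by split=> // x; exact: projection_out.
have dP : forall x, A x -> differentiable (projection p A l) x by have [] := sP 1.
apply/conformalP => // x Ax.
have dl : differentiable l.2 (event (tcoord p) x).
  by have [dl _] := sl 1; apply: dl; exact: lx.
have DP X : 'd (projection p A l) x X = 'D_(event 0 X) l.2 (event (tcoord p) x).
  rewrite -deriveE; last exact: dP.
  rewrite -slice_derive//; apply: near_eq_derive.
  by apply: (open_near_eq oA) => // y /[1!inE] Ay; rewrite projectionE.
have /shear_free_atP-/(_ dl) sf := lsf _ (lx _ Ax).
apply: screen_scalar_of_commute.
- exact: P1.
- move=> X; rewrite -deriveE; last exact: dP.
  exact: (derive_dot_unit _ oA Ax (dP _ Ax) P1).
- by move=> X; rewrite !DP projectionE//; exact: sf.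
Qed.

Lemma tcoord_ray q l (s : R) : tcoord (q + s *: tangent l q) = tcoord q + s.
Proof. by rewrite linearD linearZ/= tcoord_event [s *: _]mulr1. Qed.

Lemma spart_ray q l (s : R) : spart (q + s *: tangent l q) = spart q + s *: l.2 q.
Proof. by rewrite linearD linearZ/= spart_event. Qed.

(** The rays of [l] and [l'] through [q] meet the slice at feet differing by [s] times the
    difference of directions. The common slice field sends these feet back to the directions, so
    that difference is at most [K * |s|] times itself. *)
Lemma rays_agree_near p A l l' x : open A ->
  ray_congruences_near p A l -> ray_congruences_near p A l' ->
  (forall y, A y -> l.2 (event (tcoord p) y) = l'.2 (event (tcoord p) y)) ->
  A x -> \forall q \near event (tcoord p) x, [/\ l.1 q, l'.1 q & l.2 q = l'.2 q].
Proof.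
move=> oA lA l'A ll' Ax; set t0 := tcoord p; set q0 := event t0 x.
have sU := slice_smooth lA oA 1.
have [K [r [K0 r0 rA rK]]] := Ck1_lipschitz_near oA sU Ax.
have nl (m : congruence_data) : ray_congruences_near p A m -> nbhs q0 m.1.
  move=> [[om _ _ _] [_ Am]]; apply: open_nbhs_nbhs; split=> //.
  by apply: Am; exists x.
have [d d0 dP] := (nbhs_norm_ball _ _).1 (filterI (nl _ lA) (nl _ l'A)).
(* [d / 2] keeps the segment from [q] to its foot in both domains, [r / 2] keeps the feet in the
   Lipschitz ball, and [(2 * K)^-1] makes the contraction factor at most one half. *)
pose e := Num.min (Num.min (d / 2) (r / 2)) ((2 * K)^-1).
have e0 : 0 < e by rewrite !lt_min !divr_gt0//= invr_gt0 mulr_gt0.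
apply/nbhs_norm_ball; exists e => // q qe.
have [ed er eK] : [/\ e <= d / 2, e <= r / 2 & e <= (2 * K)^-1].
  by rewrite /e !ge_min !lexx !orbT.
have [lq l'q] : l.1 q /\ l'.1 q by apply: dP; lra.
pose s := t0 - tcoord q.
have se : `|s| < e.
  apply: le_lt_trans qe; rewrite distrC -(tcoord_event t0 x) -linearB.
  exact: tcoord_norm.
have foot (m : congruence_data) : ray_congruences_near p A m -> m.1 q ->
    (forall z, `|z - q0| < d -> m.1 z) ->
    exists y, [/\ `|y - x| < r, y = spart q + s *: m.2 q & m.2 q = m.2 (event t0 y)].
  move=> [mr [_ Am]] mq md; have [_ _ m1 _] := mr.
  exists (spart q + s *: m.2 q); split=> //.
    rewrite addrAC -(spart_event t0 x) -linearB.
    have := spart_norm (q - q0); have := ler_normD (spart (q - q0)) (s *: m.2 q).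
    rewrite normrZ; have := unit_norm_le1 (m1 _ mq).
    by have := normr_ge0 s; have := normr_ge0 (m.2 q); nra.
  rewrite -[RHS](_ : m.2 (q + s *: tangent m q) = _).
    rewrite ray_tangent_const// => t /andP[t0' t1]; apply: md.
    rewrite addrAC; have := ler_normD (q - q0) ((t * s) *: tangent m q).
    rewrite normrZ normrM (ger0_norm t0'); have := event_unit_norm_le1 (m1 _ mq).
    rewrite -/(tangent m q).
    have := normr_ge0 s; have := normr_ge0 (tangent m q).
    have : t * `|s| <= `|s| by rewrite ler_piMl.
    have : 0 <= t * `|s| by rewrite mulr_ge0.
    nra.
  congr (m.2 _); apply: event_eq; rewrite ?tcoord_ray ?spart_ray ?tcoord_event ?spart_event//.
  by rewrite /s addrC subrK.
have [y [yr yE ly]] := foot _ lA lq (fun z zd => (dP z zd).1).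
have [y' [yr' yE' ly']] := foot _ l'A l'q (fun z zd => (dP z zd).2).
split=> //; apply/eqP; rewrite -subr_eq0 -normr_le0.
have := rK _ _ yr yr'; rewrite -ly ll'; last exact: rA.
rewrite -ly' yE yE' opprD addrACA subrr add0r -scalerBr normrZ.
have : K * `|s| <= 1 / 2.
  have : K * `|s| <= K * (2 * K)^-1 by rewrite ler_pM2l// ltW// (lt_le_trans se).
  by rewrite invfM mulrCA mulfV ?gt_eqF// mulr1 div1r.
have := normr_ge0 (l.2 q - l'.2 q).
nra.
Qed.

Lemma germ_sym p A l l' : ray_congruences_near p A l ->
  germ p A l l' -> germ p A l' l.
Proof.
move=> lA [l'A [B [nB BI BE]]]; split=> //; exists B; split=> //.
  by move=> q /BI[].
by move=> q /BE.
Qed.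

Lemma germ_trans p A l l' l'' :
  germ p A l l' -> germ p A l' l'' -> germ p A l l''.
Proof.
move=> [l'A [B [nB BI BE]]] [l''A [B' [nB' BI' BE']]]; split=> //.
exists (B `&` B'); split.
- have [[oB AB] [oB' AB']] := (nB, nB').
  by split; [exact: openI|move=> q Aq; split; [exact: AB|exact: AB']].
- by move=> q [/BI[lq _] /BI'[_ l''q]].
- move=> q /[1!inE] -[Bq B'q].
  by rewrite BE ?BE' ?inE.
Qed.

Lemma germ_refl p A l : ray_congruences_near p A l -> germ p A l l.
Proof.
move=> lA; split=> //; by exists l.1; split=> //; have [] := lA.
Qed.

Lemma germ_eq p A l l' : ray_congruences_near p A l ->
  germ p A l l' -> germ p A l' = germ p A l.
Proof.
move=> lA ll'; apply/seteqP; split=> m; first exact: germ_trans.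
by apply: germ_trans; exact: germ_sym.
Qed.

(** Agreement holds near each point of the slice, so the interior of the agreement set is a common
    neighbourhood of all of [A]. *)
Lemma germ_slice_eq p A l l' : open A ->
  ray_congruences_near p A l -> ray_congruences_near p A l' ->
  (forall y, A y -> l.2 (event (tcoord p) y) = l'.2 (event (tcoord p) y)) ->
  germ p A l' = germ p A l.
Proof.
move=> oA lA l'A ll'; apply: germ_eq => //; split=> //.
exists ([set q | [/\ l.1 q, l'.1 q & l.2 q = l'.2 q]]^°)%classic.
split.
- split; first exact: open_interior.
  by move=> _ [x Ax <-]; exact: (rays_agree_near oA lA l'A ll' Ax).
- by move=> q /interior_subset[].
- by move=> q /[1!inE] /interior_subset[].
Qed.

Lemma germ_projection_eq p A l l' :
  germ p A l l' -> projection p A l' = projection p A l.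
Proof.
move=> [_ [B [[_ AB] _ BE]]]; apply/funext => x.
have [Ax|nAx] := pselect (A x); last by rewrite !projection_out.
by rewrite !projectionE// BE// inE; apply: AB; exists x.
Qed.

(* Near a compact piece of ray the congruence is the transport of its values on
   the slice, so the derivative [N] at the far end and [L] on the slice satisfy
   [N (1 + s L) = L]. *)
Lemma shear_free_transport p A l x (s : R) : open A ->
  ray_congruences_near p A l -> A x ->
  let U y := l.2 (event (tcoord p) y) in
  let q := event (tcoord p) x + s *: event 1 (U x) in
  (forall t : R, 0 <= t <= 1 ->
    l.1 (event (tcoord p) x + (t * s) *: event 1 (U x))) ->
  screen_scalar (U x) ('d U x) -> shear_free_at l q.
Proof.
move=> oA lA Ax; set t0 := tcoord p; move=> U q lseg Ls.
have [lr [_ Al]] := lA; have [ol sl l1 _] := lr.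
have dU y : A y -> differentiable U y by have [+ _] := slice_smooth lA oA 1; exact.
have lx y : A y -> l.1 (event t0 y) by move=> Ay; apply: Al; exists y.
have lq : l.1 q by have := lseg 1; rewrite mul1r; apply; rewrite ler01 lexx.
have dl : differentiable l.2 q by have [dl _] := sl 1; exact: dl.
pose P y (t : R) := l.1 (event t0 y + (t * s) *: event 1 (U y)).
(* By compactness of the parameter interval, rays from nearby feet also stay in the domain up to
   parameter [s]. The identity [l.2 (g y) = U y] thus holds near [x] and may be differentiated. *)
have tube : \forall y \near x, `[0, 1] `<=` P y.
  have cover := (compact_near_coveringP _).1 (@segment_compact R 0 1).
  suff lP (t : R) : `[0, 1]%classic t -> \forall t' \near t & y \near x, P y t'.
    exact: (cover _ (nbhs x) P _ lP).
  rewrite /= in_itv/= => t01.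
  have cP : {for (t, x), continuous (fun z : R * 'rV[R]_3 =>
      event t0 z.2 + (z.1 * s) *: event 1 (U z.2))}.
    have c2 : continuous_at (t, x) (fun z : R * 'rV[R]_3 => z.2) by exact: cvg_snd.
    apply: continuousD.
      exact: (@continuous_comp _ _ _ snd (event t0) _ c2 (@continuous_event _ _ _)).
    apply: continuousZ.
      apply: continuousM; [exact: cvg_fst|exact: cst_continuous].
    have cU := @continuous_comp _ _ _ snd U _ c2 (differentiable_continuous (dU _ Ax)).
    exact: (@continuous_comp _ _ _ (U \o snd) (event 1) _ cU (@continuous_event _ _ _)).
  exact: (cP _ (open_nbhs_nbhs (conj ol (lseg t t01)))).
pose g (y : 'rV[R]_3) := event (t0 + s) (y + s *: U y).
have near_g : \forall y \near x, l.2 (g y) = U y.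
  have := open_nbhs_nbhs (conj oA Ax : open_nbhs x A).
  apply: filterS2 tube => y tuby Ay.
  rewrite /g -event_ray; apply: ray_tangent_const => //; first exact: lx.
have gq : g x = q by rewrite /g /q event_ray.
have lqU : l.2 q = U x by rewrite -gq; exact: (nbhs_singleton near_g).
have dh : differentiable (fun y => y + s *: U y) x.
  by apply: (@differentiableD _ _ _ id (s *: U)) => //; apply: differentiableZ; exact: dU.
have Dh X : 'D_X (fun y => y + s *: U y) x = X + s *: 'D_X U x.
  have dU' := diff_derivable (v := X) (dU _ Ax).
  rewrite (@deriveD _ _ _ id (s *: U)); [|exact: derivable_id|exact: derivableZ].
  by rewrite derive_id deriveZ.
have [de _] := is_diff_event (t0 + s) (x + s *: U x) 0.
have dg : differentiable g x := differentiable_comp dh de.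
(* The time of [g y] is fixed at [t0 + s], so only spatial derivatives of [l.2] enter, and these
   make up [N]. *)
have Dg X : 'D_X g x = event 0 (X + s *: 'D_X U x).
  rewrite -Dh; apply: etrans (derive_comp X dh de) _.
  exact: (is_diff_event _ _ _).2.
pose N : {linear 'rV[R]_3 -> 'rV[R]_3} := ('d (l.2) q \o event 0).
have NE X : N X = 'D_(event 0 X) l.2 q by rewrite deriveE.
have NL X : N (X + s *: 'd U x X) = 'd U x X.
  have dlg : differentiable l.2 (g x) by rewrite gq.
  rewrite -(deriveE X (dU _ Ax)) NE -Dg -gq -(derive_comp X dg dlg).
  exact: near_eq_derive.
apply/shear_free_atP => // Y.
rewrite lqU -!NE => Yu.
apply: (screen_scalar_transport _ (L := 'd U x) (N := N) (s := s)) => //.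
by rewrite l1//; exact: lx.
Qed.

End Rays.

(** * The implicit function theorem and extension *)

Section CkMatrix.
Context {R : realType} {V : normedModType R}.

Lemma Ck_det m n (A : set V) (M : V -> 'M[R]_m) : open A ->
  (forall i j, Ck n A (fun x => M x i j)) -> Ck n A (fun x => \det (M x)).
Proof.
move=> oA CM; apply: Ck_sum => // s; apply: CkM => //; first exact: Ck_cst.
exact: Ck_prod.
Qed.

Lemma Ck_invmx m n (A : set V) (M : V -> 'M[R]_m) i j : open A ->
  (forall x, A x -> M x \in unitmx) ->
  (forall i j, Ck n A (fun x => M x i j)) -> Ck n A (fun x => invmx (M x) i j).
Proof.
move=> oA uM CM.
have Cc : Ck n A (fun x => (\det (M x))^-1 * cofactor (M x) j i).
  apply: CkM => //.
    apply: CkV => // [x /uM|]; last exact: Ck_det.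
    by rewrite unitmxE unitfE.
  apply: CkM => //; first exact: Ck_cst.
  by apply: Ck_det => // a b; under eq_fun do rewrite !mxE.
apply: Ck_eq Cc => // x /[1!inE] Ax.
by rewrite /invmx uM// !mxE.
Qed.

End CkMatrix.

Lemma implicit_remainder {R : realType} m (a b g a' b' : 'rV[R]_m) (t s : R) :
  a' - b' + s *: g - (a' + (t + s) *: a - (b' + s *: b) - t *: b) =
  - (s *: (a - b - g)) - t *: (a - b).
Proof. by apply/rowP => i; rewrite !mxE; ring. Qed.

Section Implicit.
Context {R : realType} {n m : nat}.
Variables (B : set 'rV[R]_n) (A : set 'rV[R]_m) (U : 'rV[R]_m -> 'rV[R]_m).
Variables (X : 'rV[R]_n -> 'rV[R]_m) (sigma : 'rV[R]_n -> R).
Variables (tau : {linear 'rV[R]_n -> R}) (y : {linear 'rV[R]_n -> 'rV[R]_m}).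
Hypotheses (oB : open B) (oA : open A) (sU : smooth_on A U).
Hypothesis sigmaE : forall h q : 'rV[R]_n, sigma (h + q) = tau h + sigma q.
Hypothesis AX : forall q, B q -> A (X q).
Hypothesis XE : forall q, B q -> X q + sigma q *: U (X q) = y q.
Hypothesis Xlip : forall q, B q -> exists2 C : R, 0 < C &
  \forall h \near (0 : 'rV[R]_n), `|X (h + q) - X q| <= C * `|h|.
Hypothesis Uinj : forall q, B q ->
  forall v, v + sigma q *: 'D_v U (X q) = 0 -> v = 0.

Let M q : 'M[R]_m := 1%:M + sigma q *: lin1_mx ('d U (X q)).

Let dU x : A x -> differentiable U x. Proof. by have [+ _] := sU 1; exact. Qed.

Let mulM q v : v *m M q = v + sigma q *: 'd U (X q) v.
Proof. by rewrite mulmxDr mulmx1 -scalemxAr mul_rV_lin1. Qed.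

Let unitM q : B q -> M q \in unitmx.
Proof.
move=> Bq; rewrite -row_free_unit; apply: inj_row_free => v.
by rewrite mulM -deriveE; [exact: Uinj|exact/dU/AX].
Qed.

(** The solution of [XE] after formal differentiation; the matrix acts on the right of row
    vectors. *)
Let dX q (h : 'rV[R]_n) : 'rV[R]_m := (y h - tau h *: U (X q)) *m invmx (M q).

Let dX_linear q : linear (dX q).
Proof.
move=> a u v; rewrite /dX !linearP/= scalemxAl -mulmxDl; congr (_ *m _).
by rewrite scalerDl -scalerA scalerBr opprD addrACA.
Qed.

(** The increment of [X] satisfies the differentiated equation up to [E]. The Lipschitz bound on [X]
    turns the first-order error of [U], taken at [X (h + q)], into [o(h)], and inverting [M q]
    preserves this. *)
Lemma implicit_derive q : B q ->
  differentiable X q /\ 'd X q = dX q :> (_ -> _).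
Proof.
move=> Bq.
pose dXM := GRing.isLinear.Build _ _ _ _ _ (dX_linear q).
pose dXL : {linear _ -> _} := HB.pack (dX q) dXM.
apply: (@approx_diff _ _ _ X q dXL); first exact: linear_row_continuous.
move=> e e0 /=.
have [C C0 XC] := Xlip Bq.
have dUX : differentiable U (X q) by exact/dU/AX.
have [c c0 Mc] := linear_lipschitz (@linear_row_continuous _ _ _ (mulmxr (invmx (M q)))).
have [k k0 tk] := linear_lipschitz (@linear_row_continuous _ _ _ tau).
(* [D] collects the bounds for [invmx (M q)], [X] and [tau]. With tolerance [d = e / D] for [U], the
   final error is [d * D * |h| = e * |h|]. *)
pose D := c * (`|sigma q| * C + k).
have D0 : 0 < D by rewrite mulr_gt0// ltr_wpDl// mulr_ge0// ltW.
pose d := e / D.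
have d0 : 0 < d by exact: divr_gt0.
have Xq0 (P : set 'rV[R]_m) : nbhs (0 : 'rV[R]_m) P ->
    \forall h \near (0 : 'rV[R]_n), P (X (h + q) - X q).
  move=> /nbhs_norm_ball[b b0 bP]; have bC : 0 < b / C by exact: divr_gt0.
  have nb : nbhs (0 : 'rV[R]_n) [set h | `|h| < b / C].
    by apply/nbhs_norm_ball; exists (b / C) => // h; rewrite subr0.
  apply: filterS2 XC nb => h Xh hb; apply: bP; rewrite subr0.
  by apply: (le_lt_trans Xh); rewrite mulrC -ltr_pdivlMr.
have Ulin : \forall h \near (0 : 'rV[R]_n),
    `|U (X (h + q)) - U (X q) - 'd U (X q) (X (h + q) - X q)| <= d * `|X (h + q) - X q|.
  have := Xq0 _ (diff_approx dUX d0).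
  by apply: filterS => h /=; rewrite subrK.
have Ucont : \forall h \near (0 : 'rV[R]_n), `|U (X (h + q)) - U (X q)| <= d.
  have UX0 : \forall z \near (0 : 'rV[R]_m), `|U (z + X q) - U (X q)| <= d.
    have : \forall z \near X q, `|U (X q) - U z| <= d.
      exact: (cvgrPdist_le _ _).1 (differentiable_continuous dUX) d d0.
    rewrite (near_shift 0 (X q)) subr0.
    by apply: filterS => z /=; rewrite distrC.
  by have := Xq0 _ UX0; apply: filterS => h /=; rewrite subrK.
have nB : \forall h \near (0 : 'rV[R]_n), B (h + q).
  have : \forall z \near q, B z := open_nbhs_nbhs (conj oB Bq : open_nbhs q B).
  by rewrite (near_shift 0 q) subr0.
near=> h.
have XCh : `|X (h + q) - X q| <= C * `|h| by near: h.
have Uh : `|U (X (h + q)) - U (X q)| <= d by near: h.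
have Ulh : `|U (X (h + q)) - U (X q) - 'd U (X q) (X (h + q) - X q)|
    <= d * `|X (h + q) - X q| by near: h.
have Bh : B (h + q) by near: h.
set Z := X (h + q) - X q in XCh Ulh *.
pose E := - (sigma q *: (U (X (h + q)) - U (X q) - 'd U (X q) Z)) -
  tau h *: (U (X (h + q)) - U (X q)).
have EE : Z *m M q - (y h - tau h *: U (X q)) = E.
  rewrite mulM /E.
  have -> : y h = y (h + q) - y q by rewrite linearD addrK.
  rewrite -(XE Bh) -(XE Bq) sigmaE /Z.
  exact: implicit_remainder.
have -> : Z - dX q h = mulmxr (invmx (M q)) E.
  by rewrite /= -EE mulmxBl mulmxK// unitM.
apply: (le_trans (Mc _)).
have nE : `|E| <= d * (`|sigma q| * C + k) * `|h|.
  rewrite /E -opprD normrN (le_trans (ler_normD _ _))// !normrZ.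
  have s0 := normr_ge0 (sigma q).
  have : `|sigma q| * `|U (X (h + q)) - U (X q) - 'd U (X q) Z| <= `|sigma q| * (d * (C * `|h|)).
    by rewrite ler_wpM2l// (le_trans Ulh)// ler_wpM2l// ltW.
  have : `|tau h| * `|U (X (h + q)) - U (X q)| <= (k * `|h|) * d.
    by rewrite ler_pM.
  lra.
apply: (@le_trans _ _ (c * (d * (`|sigma q| * C + k) * `|h|))).
  by rewrite ler_wpM2l// ltW.
have -> : c * (d * (`|sigma q| * C + k) * `|h|) = d * D * `|h|.
  by rewrite /D; ring.
by rewrite /d divfK ?gt_eqF.
Unshelve. all: by end_near. Qed.

(** Bootstrap: the formula [dX] involves only [X] itself, [U] with its derivative at [X], and a
    matrix inverse, so order [k] of [X] gives order [k] of its derivative. *)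
Lemma implicit_smooth : smooth_on B X.
Proof.
move=> k; elim: k => [|k IH].
  by move=> q Bq; exact/differentiable_continuous/(implicit_derive Bq).1.
split=> [q Bq|v]; first exact: (implicit_derive Bq).1.
have Ctau := Ck_linear k B (@linear_row_continuous _ _ _ tau).
have Csigma : Ck k B sigma.
  have := CkD oB Ctau (Ck_cst k B (sigma 0)).
  by apply: Ck_eq => // q _; rewrite -sigmaE addr0.
have CM i j : Ck k B (fun q => M q i j).
  have [_ /(_ (delta_mx 0 i)) DU] := sU k.+1.
  have CU := Ck_coord j oB (Ck_comp oB AX IH DU).
  have := CkD oB (Ck_cst k B ((i == j)%:R : R)) (CkM oB Csigma CU).
  apply: Ck_eq => // q /[1!inE] Bq.
  by rewrite !mxE deriveE//; exact/dU/AX.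
have CdX : Ck k B (fun q => dX q v).
  apply: Ck_row => // j.
  under eq_fun do rewrite mxE.
  apply: Ck_sum => // i; apply: CkM => //; last exact: Ck_invmx.
  have CU := Ck_coord i oB (Ck_comp oB AX IH (sU k)).
  have := CkD oB (Ck_cst k B (y v 0 i)) (CkM oB (Ck_cst k B (- tau v)) CU).
  by apply: Ck_eq => // q _; rewrite !mxE mulNr.
apply: Ck_eq CdX => // q /[1!inE] Bq.
have [dXq <-] := implicit_derive Bq.
by rewrite deriveE.
Qed.

End Implicit.

(** Provides the completeness required by [banach_fixed_point] in the construction of feet. *)
HB.instance Definition _ (R : realType) m n := Complete.on 'M[R]_(m, n).

Lemma foot_difference {R : realType} m (x x' u u' y h : 'rV[R]_m) (s t : R) :
  x + s *: u = y -> x' + (t + s) *: u' = h + y ->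
  x' - x = h - t *: u' - s *: (u' - u).
Proof.
move=> <- /(canRL (addrK _)) ->.
by apply/rowP => i; rewrite !mxE; ring.
Qed.

(** * Feet of rays and the extended congruence *)

Section Extension.
Context {R : realType}.
Variables (A : set 'rV[R]_3) (U : 'rV[R]_3 -> 'rV[R]_3) (t0 : R).
Hypotheses (oA : open A) (sU : smooth_on A U).
Hypothesis U1 : forall x, A x -> dot (U x) (U x) = 1.

(** One number serves as radius and as inverse Lipschitz constant. Decreasing it weakens both
    conditions, so they pass together to nearby centres. *)
Definition lipschitz_ball (r : R) (y : 'rV[R]_3) : Prop :=
  [/\ 0 < r, (forall z, `|z - y| < r -> A z) &
    forall a b, `|a - y| < r -> `|b - y| < r -> r * `|U a - U b| <= `|a - b|].

Lemma lipschitz_ball_exists x : A x -> exists r, lipschitz_ball r x.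
Proof.
move=> Ax; have [K [r [K0 r0 rA rK]]] := Ck1_lipschitz_near oA (sU 1) Ax.
have K0' : 0 < K^-1 by rewrite invr_gt0.
exists (Num.min r K^-1); split; first by rewrite lt_min r0.
  by move=> z; rewrite lt_min => /andP[/rA].
move=> a b; rewrite !lt_min => /andP[ar _] /andP[br _].
apply: (@le_trans _ _ (K^-1 * `|U a - U b|)).
  by rewrite ler_wpM2r// ge_min lexx orbT.
by rewrite mulrC ler_pdivrMr// mulrC; exact: rK.
Qed.

Lemma lipschitz_ball_shrink r d y y' : lipschitz_ball r y ->
  `|y' - y| <= d -> d < r -> lipschitz_ball (r - d) y'.
Proof.
move=> [r0 rA rU] yd dr.
have sub z : `|z - y'| < r - d -> `|z - y| < r.
  move=> zy; rewrite -(subrK y' z) -addrA.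
  by apply: (le_lt_trans (ler_normD _ _)); lra.
split; first by rewrite subr_gt0.
  by move=> z /sub/rA.
move=> a b /sub ar /sub br; apply: le_trans (rU _ _ ar br).
by rewrite ler_wpM2r// gerBl (le_trans _ yd).
Qed.

(* The factor 8 makes [z |-> y - s *: U z] a contraction of the ball of radius
   [r / 2] around [y], and makes the domain star-shaped along each ray. *)
Definition ext_dom : set 'rV[R]_4 :=
  [set q | exists2 r, lipschitz_ball r (spart q) & 8 * `|tcoord q - t0| < r].

Lemma open_ext_dom : open ext_dom.
Proof.
rewrite openE => q [r rq qr]; apply/nbhs_norm_ball.
(* Here 9 is 8 + 1: a move by less than [e] costs less than [8 * e] in time, and the radius shrinks
   by [e]. *)
pose e := (r - 8 * `|tcoord q - t0|) / 9.
have e0 : 0 < e by rewrite divr_gt0// subr_gt0.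
have n0 := normr_ge0 (tcoord q - t0).
have re : r = 8 * `|tcoord q - t0| + 9 * e by rewrite /e; field.
exists e => // q' qe; exists (r - e).
  apply: lipschitz_ball_shrink rq _ _; last by lra.
  by rewrite -linearB (le_trans (spart_norm _))// ltW.
have : `|tcoord q' - tcoord q| < e.
  by rewrite -linearB (le_lt_trans (tcoord_norm _)).
have := ler_normD (tcoord q' - tcoord q) (tcoord q - t0).
rewrite addrA subrK; lra.
Qed.

Definition is_foot q x := A x /\ x + (tcoord q - t0) *: U x = spart q.

(** As [U] is a unit field, every foot in [A] is automatically close to [spart q]. Uniqueness
    therefore holds among all points of [A], not only among nearby ones. *)
Lemma is_foot_dist q x : is_foot q x -> `|x - spart q| <= `|tcoord q - t0|.
Proof.
move=> [Ax <-]; rewrite opprD addrA subrr add0r normrN normrZ.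
by rewrite ler_piMr//; exact/unit_norm_le1/U1.
Qed.

Lemma is_foot_unique q x x' : ext_dom q -> is_foot q x -> is_foot q x' -> x = x'.
Proof.
move=> [r [r0 rA rU] qr] fx fx'.
have dx := is_foot_dist fx; have dx' := is_foot_dist fx'.
have n0 := normr_ge0 (tcoord q - t0).
have xr : `|x - spart q| < r by lra.
have xr' : `|x' - spart q| < r by lra.
have := rU _ _ xr xr'.
move: fx fx' => [_ xq] [_ /esym]; rewrite -{}xq.
set s := tcoord q - t0 in qr n0 * => xx'.
have -> : x - x' = s *: (U x' - U x).
  by rewrite scalerBr -{1}[x](addrK (s *: U x)) xx' addrAC [x' + _]addrC addrK.
rewrite normrZ (distrC (U x')) => rs.
have UU : `|U x - U x'| = 0.
  have := normr_ge0 (U x - U x'); nra.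
move/eqP: UU; rewrite normr_eq0 subr_eq0 => /eqP UU.
by move: xx'; rewrite UU => /addIr.
Qed.

Lemma is_foot_exists q : ext_dom q -> exists x, is_foot q x.
Proof.
move=> [r [r0 rA rU] qr]; set s := tcoord q - t0 in qr; set y := spart q in rA rU.
have n0 := normr_ge0 s.
(* A closed ball, as the fixed point theorem wants, inside the open Lipschitz ball; [f] moves the
   centre by at most [r / 8]. *)
pose D : set 'rV[R]_3 := [set z | `|y - z| <= r / 2].
have DA z : D z -> `|z - y| < r by rewrite /D/= distrC; lra.
pose f z : 'rV[R]_3 := y - s *: U z.
have fD : {homo f : z / D z}.
  move=> z /DA/rA Az; rewrite /D/= /f opprB addrC subrK normrZ.
  have := unit_norm_le1 (U1 Az); have := normr_ge0 (U z); nra.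
have q0 : 0 <= 8^-1 :> R by rewrite invr_ge0.
have fctr : is_contraction (mkfun_fun fD).
  exists (NngNum q0); split=> /=; first by rewrite invf_lt1 ?ltr1n.
  move=> [a b] [/= /DA ar /DA br].
  rewrite /mkfun /f opprD addrACA subrr add0r opprK addrC -scalerBr normrZ (distrC (U b)).
  have := rU _ _ ar br; have := normr_ge0 (U a - U b).
  set c := `|U a - U b|; set d := `|a - b| => c0 rc.
  have : 8 * (`|s| * c) <= d by nra.
  lra.
have cD : closed D.
  have r2 : 0 < r / 2 by exact: divr_gt0.
  have -> : D = closed_ball y (r / 2) by rewrite closed_ballE.
  exact: closed_ball_closed.
have D0 : D !=set0 by exists y; rewrite /D/= subrr normr0 divr_ge0// ltW.
have [x Dx fx] := banach_fixed_point fctr cD D0.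
exists x; split; first exact/rA/DA.
by rewrite {1}fx /= /mkfun /f subrK.
Qed.

Definition foot q := get (is_foot q).

Lemma footP q : ext_dom q -> is_foot q (foot q).
Proof. by move=> /is_foot_exists; exact: getPex. Qed.

Lemma foot_lipschitz q : ext_dom q -> exists2 C : R, 0 < C &
  \forall h \near (0 : 'rV[R]_4), `|foot (h + q) - foot q| <= C * `|h|.
Proof.
(* The displacement [E] of the foot satisfies [|E| <= 2 * |h| + |E| / 8], whence [16 / 7 < 3]. *)
move=> dq; exists 3 => //.
have [r [r0 rA rU] qr] := dq.
have n0 := normr_ge0 (tcoord q - t0).
have [d d0 dE] : exists2 d : R, 0 < d & forall h : 'rV[R]_4, `|h| < d -> ext_dom (h + q).
  have /nbhs_norm_ball[d d0 dE] := open_nbhs_nbhs (conj open_ext_dom dq : open_nbhs q ext_dom).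
  by exists d => // h hd; apply: dE; rewrite addrK.
apply/nbhs_norm_ball; exists (Num.min d (r / 8)); first by rewrite lt_min d0 divr_gt0.
move=> h; rewrite subr0 lt_min => /andP[hd hr].
have fq := footP dq; have fhq := footP (dE _ hd).
have dx := is_foot_dist fq; have dx' := is_foot_dist fhq.
have th := tcoord_norm h; have sh := spart_norm h.
have tE : tcoord (h + q) - t0 = tcoord h + (tcoord q - t0) by rewrite linearD addrA.
have xr : `|foot q - spart q| < r by lra.
have xr' : `|foot (h + q) - spart q| < r.
  have -> : foot (h + q) - spart q = foot (h + q) - spart (h + q) + spart h.
    by rewrite [spart (h + q)]linearD opprD addrA addrAC subrK.
  have := ler_normD (foot (h + q) - spart (h + q)) (spart h).
  have := ler_normD (tcoord h) (tcoord q - t0).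
  move: dx'; rewrite tE; lra.
have := rU _ _ xr' xr.
have [[Ax xq] [Ax' xq']] := (fq, fhq).
have u1 := unit_norm_le1 (U1 Ax'); have u0 := normr_ge0 (U (foot (h + q))).
set x := foot q in xq Ax *; set x' := foot (h + q) in xq' Ax' u1 u0 *.
have -> : x' - x = spart h - tcoord h *: U x' - (tcoord q - t0) *: (U x' - U x).
  by apply: foot_difference xq _; rewrite -tE xq' linearD.
set E := spart h - _ - _ => rE.
have : `|E| <= `|h| + `|h| + `|tcoord q - t0| * `|U x' - U x|.
  rewrite (le_trans (ler_normB _ _))// normrZ lerD2r.
  rewrite (le_trans (ler_normB _ _))// lerD// normrZ.
  rewrite -[leRHS]mulr1 ler_pM//.
have : 8 * (`|tcoord q - t0| * `|U x' - U x|) <= r * `|U x' - U x|.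
  by rewrite mulrA ler_wpM2r// ltW.
have := normr_ge0 h; lra.
Qed.

(** Injectivity of [1 + s DU] at the foot comes from smallness: [|s| < r / 8] and a derivative bound
    [2 / r] leave [s DU] of norm at most one quarter. *)
Lemma foot_smooth : smooth_on ext_dom foot.
Proof.
apply: (@implicit_smooth _ _ _ ext_dom A U foot (fun q => tcoord q - t0) tcoord spart).
- exact: open_ext_dom.
- exact: sU.
- by move=> h q; rewrite linearD addrA.
- by move=> q /footP[].
- by move=> q /footP[].
- exact: foot_lipschitz.
move=> q dq v vE; have [r [r0 rA rU] qr] := dq.
have fq := footP dq; have dx := is_foot_dist fq.
have n0 := normr_ge0 (tcoord q - t0); set x := foot q in fq vE dx.
have dU : differentiable U x by have [+ _] := sU 1; apply; exact: fq.1.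
have xr : `|x - spart q| < r by lra.
(* [U] is [1/r]-Lipschitz near [x], so its differential is bounded by [2/r]. *)
have DU : r * `|'d U x v| <= 2 * `|v|.
  have r0' : 0 < r^-1 by rewrite invr_gt0.
  have [e e0 eP] := (nbhs_norm_ball _ _).1 (diff_approx dU r0').
  have [->|v0] := eqVneq v 0; first by rewrite linear0 !normr0 !mulr0.
  have vp : 0 < `|v| by rewrite normr_gt0.
  (* Scales [v] into both the approximation ball and the Lipschitz ball. The tolerance [r^-1] of the
     approximation supplies the second [1 / r] of the bound, so no limit has to be taken. *)
  pose t := Num.min e (r - `|x - spart q|) / (2 * `|v|).
  have m0 : 0 < Num.min e (r - `|x - spart q|) by rewrite lt_min e0 subr_gt0.
  have tp : 0 < t by rewrite divr_gt0// mulr_gt0.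
  have tv : `|t *: v| = Num.min e (r - `|x - spart q|) / 2.
    by rewrite normrZ gtr0_norm// /t; field; rewrite gt_eqF.
  have te : `|t *: v| < e.
    have : Num.min e (r - `|x - spart q|) <= e by rewrite ge_min lexx.
    by rewrite tv; lra.
  have tr : `|t *: v + x - spart q| < r.
    have : Num.min e (r - `|x - spart q|) <= r - `|x - spart q| by rewrite ge_min lexx orbT.
    have := ler_normD (t *: v) (x - spart q); rewrite addrA tv; lra.
  have := eP (t *: v); rewrite subr0 => /(_ te) H1.
  have := rU _ _ tr xr; rewrite addrK => H2.
  have H3 : `|'d U x (t *: v)| <= `|U (t *: v + x) - U x| + r^-1 * `|t *: v|.
    have -> : 'd U x (t *: v) = (U (t *: v + x) - U x) - (U (t *: v + x) - U x - 'd U x (t *: v)).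
      by rewrite opprB addrC subrK.
    by rewrite (le_trans (ler_normB _ _))// lerD2l.
  have : r * `|'d U x (t *: v)| <= 2 * `|t *: v|.
    have : r * `|'d U x (t *: v)| <= r * (`|U (t *: v + x) - U x| + r^-1 * `|t *: v|).
      by rewrite ler_pM2l.
    rewrite mulrDr mulrA mulfV ?gt_eqF// mul1r; lra.
  rewrite linearZ/= (normrZ t v) (normrZ t) !(mulrCA _ `|t|) ler_pM2l//.
  by rewrite gtr0_norm.
move: vE; rewrite deriveE// => /eqP; rewrite addr_eq0 => /eqP vE.
have nv : `|v| = `|tcoord q - t0| * `|'d U x v| by rewrite {1}vE normrN normrZ.
apply/eqP; rewrite -normr_le0.
have := normr_ge0 ('d U x v); have := normr_ge0 v; nra.
Qed.

Definition extension : @congruence_data R := (ext_dom, U \o foot).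

(** The foot of [q] solves the foot equation of every event on its line, and uniqueness in [ext_dom]
    concludes, even if the line meets the domain in several pieces. *)
Lemma foot_ray q (s : R) : ext_dom q ->
  let q' := q + s *: tangent extension q in ext_dom q' -> foot q' = foot q.
Proof.
move=> dq q' dq'; apply: (is_foot_unique dq' (footP dq')).
have [Ax xq] := footP dq; split=> //.
by rewrite tcoord_ray spart_ray (addrAC (tcoord q)) scalerDl addrA xq.
Qed.

Lemma ext_dom_slice x : A x -> ext_dom (event t0 x).
Proof.
move=> /lipschitz_ball_exists[r rx]; exists r; rewrite ?spart_event//.
by rewrite tcoord_event subrr normr0 mulr0; case: rx.
Qed.

Lemma ray_congruence_extension : ray_congruence extension.
Proof.
split=> [|n|q dq|q dq].
- exact: open_ext_dom.
- apply: (Ck_comp open_ext_dom _ (foot_smooth n) (sU n)).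
  by move=> q /footP[].
- by apply: U1; have [] := footP dq.
exists (tangent extension q); split.
- apply/eqP => /(congr1 tcoord); rewrite tcoord_event linear0 => /eqP.
  by rewrite oner_eq0.
- rewrite /gM !tcoord_event !spart_event mulr1 U1 ?addNr//.
  by have [] := footP dq.
move=> q' /connected_component_sub[dq' [s _ qs]]; exists 1; rewrite scale1r.
rewrite /tangent /extension/= -qs (foot_ray dq)//.
by rewrite /= qs.
Qed.

Lemma extension_component q : ext_dom q ->
  connected_component (ext_dom `&` line (event t0 (foot q)) (event 1 (U (foot q))))
    (event t0 (foot q)) q.
Proof.
move=> dq; have [Ax xq] := footP dq; set x := foot q in Ax xq *.
set s := tcoord q - t0 in xq.
have qE : q = event t0 x + s *: event 1 (U x).
  by rewrite event_ray xq /s addrC subrK event_coords.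
rewrite {1}qE; apply: segment_component => t t01; split; last first.
  by exists (t * s); rewrite // scalerA.
have [r rq qr] := dq; have /andP[t0' t1] := t01.
have s0 := normr_ge0 s; rewrite -/s in qr.
(* At parameter [t] the event has moved in space by at most [(1 - t) * |s|]. The remaining radius
   exceeds [(7 + t) * |s|] when [s] is nonzero, hence [8 * t * |s|]. *)
exists (r - (1 - t) * `|s|).
  apply: lipschitz_ball_shrink rq _ _; last by nra.
  rewrite scalerA event_ray spart_event -xq opprD addrACA subrr add0r -scalerBl.
  rewrite normrZ -{2}(mul1r s) -mulrBl normrM distrC.
  rewrite (ger0_norm (_ : 0 <= 1 - t)) ?subr_ge0//.
  by rewrite ler_piMr ?mulr_ge0 ?subr_ge0//; exact/unit_norm_le1/U1.
rewrite scalerA event_ray tcoord_event addrAC subrr add0r normrM (ger0_norm t0').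
nra.
Qed.

End Extension.

(** * The correspondence *)

Section Correspondence.
Context {R : realType}.
Variables (p : 'rV[R]_4) (A : set 'rV[R]_3).
Hypothesis oA : open A.
Implicit Types (l : @congruence_data R) (U : 'rV[R]_3 -> 'rV[R]_3).

Lemma is_extension_exists U : oriented_foliation A U ->
  is_extension p A U (extension A U (tcoord p)).
Proof.
move=> [sU U1 _]; split.
  split; first exact: ray_congruence_extension.
  split; first exact: open_ext_dom.
  by move=> _ [x Ax <-]; exact: ext_dom_slice.
move=> q dq; exists (foot A U (tcoord p) q); split=> //.
- by have [] := footP U1 dq.
- exact: extension_component.
Qed.

(** The ray through a slice event starts at an event of the same time, so its parameter is 0 and the
    foot is the point itself. *)
Lemma is_extension_slice U l x : is_extension p A U l -> A x ->
  l.2 (event (tcoord p) x) = U x.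
Proof.
move=> [[_ [_ Al]] lU] Ax.
have [|y [_ /connected_component_sub[_ [s _ ys]] ->]] := lU (event (tcoord p) x).
  by apply: Al; exists x.
move: ys; rewrite event_ray => /event_inj[/eqP].
rewrite addrC -subr_eq0 addrK => /eqP -> /esym.
by rewrite scale0r addr0 => ->.
Qed.

(** The component condition in [is_extension] joins each event of the domain to the slice by a ray
    segment inside the domain, along which [shear_free_transport] applies. *)
Lemma is_extension_shear_free U l : conformal_foliations A U ->
  is_extension p A U l -> shear_free_rays p A l.
Proof.
move=> [[sU U1 U0] cU] lU; have [lA lq] := lU; split=> // q /lq[x [Ax qx _]].
have dU y : A y -> differentiable U y by have [+ _] := sU 1; exact.
have lx := is_extension_slice lU Ax.
have [_ [s _ qs]] := connected_component_sub qx.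
rewrite -qs in qx *.
have seg := component_segment (tcoord_event 1 (U x)) qx.
pose V y := l.2 (event (tcoord p) y).
have [dV _] : Ck 1 A V := slice_smooth lA oA 1.
have VU X : 'd V x X = 'd U x X.
  apply: etrans (esym (deriveE X (dV x Ax))) (etrans _ (deriveE X (dU x Ax))).
  apply: near_eq_derive; apply: (open_near_eq oA) => // y /[1!inE] Ay.
  exact: is_extension_slice lU Ay.
have Vx : V x = U x := lx.
have sV : screen_scalar (V x) ('d V x).
  have [a [b Uab]] := (conformalP oA dU U1).1 cU x Ax.
  exists a, b => X Xu; apply: (etrans (VU X)).
  by rewrite Vx; apply: Uab; rewrite -Vx.
rewrite -Vx in seg *.
exact: (shear_free_transport oA lA Ax seg sV).
Qed.

Lemma germ_extension_eq U l : is_extension p A U l ->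
  germ_extension p A U = germ p A l.
Proof.
move=> lU; have gU : is_extension p A U (get (is_extension p A U)).
  exact: (getPex (ex_intro _ l lU)).
apply: (germ_slice_eq oA lU.1 gU.1) => y Ay.
by rewrite (is_extension_slice lU Ay) (is_extension_slice gU Ay).
Qed.

(** [get] may return a member of the germ with shear away from the slice, so the statement covers
    all ray congruences. *)
Lemma germ_projectionE l : ray_congruences_near p A l ->
  germ_projection p A (germ p A l) = projection p A l.
Proof.
move=> lA; apply: germ_projection_eq.
exact: (getPex (ex_intro _ l (germ_refl lA))).
Qed.

Lemma projection_extension U l : conformal_foliations A U ->
  is_extension p A U l -> projection p A l = U.
Proof.
move=> [[_ _ U0] _] lU; apply/funext => x.
have [Ax|nAx] := pselect (A x); last by rewrite projection_out// U0.
by rewrite projectionE// (is_extension_slice lU Ax).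
Qed.

Lemma germ_projection_inj l l' :
  ray_congruences_near p A l -> ray_congruences_near p A l' ->
  projection p A l = projection p A l' -> germ p A l = germ p A l'.
Proof.
move=> lA l'A ll'; apply: (germ_slice_eq oA l'A lA) => y Ay.
by rewrite -!(projectionE p _ Ay) ll'.
Qed.

End Correspondence.

Unset Implicit Arguments.

Theorem theoremS3p2 (R : realType) (p : 'rV[R]_4) (A : set 'rV[R]_3)
    (openA : open A) :
  [/\ (* projection does not depend on the representative of the germ *)
      (forall l l', shear_free_rays p A l -> germ p A l l' ->
         projection p A l' = projection p A l),
      (* extensions exist and their germ is unique *)
      (forall U, conformal_foliations A U ->
         (exists l, is_extension p A U l) /\
         (forall l, is_extension p A U l ->
            shear_free_germs p A (germ p A l) /\
            germ_extension p A U = germ p A l)),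
      set_bij (shear_free_germs p A) (conformal_foliations A)
        (germ_projection p A),
      (forall g, shear_free_germs p A g ->
         germ_extension p A (germ_projection p A g) = g)
    & (forall U, conformal_foliations A U ->
         germ_projection p A (germ_extension p A U) = U)].
Proof.
split.
- by move=> l l' _; exact: germ_projection_eq.
- move=> U cU; split.
    exists (extension A U (tcoord p)).
    exact: (is_extension_exists p openA cU.1).
  move=> l lU; split; last exact: germ_extension_eq.
  by exists l => //; exact: is_extension_shear_free cU lU.
- split.
  + by move=> _ [l ll <-]; rewrite germ_projectionE; [exact: projection_conformal|exact: ll.1].
  + move=> _ _ /[1!inE] -[l ll <-] /[1!inE] -[l' ll' <-].
    rewrite !germ_projectionE; [|exact: ll'.1|exact: ll.1].
    exact: germ_projection_inj ll.1 ll'.1.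
  + move=> U cU; have lU := is_extension_exists p openA cU.1.
    have lsf := is_extension_shear_free openA cU lU.
    exists (germ p A (extension A U (tcoord p))).
      by exists (extension A U (tcoord p)).
    by rewrite germ_projectionE; [exact: projection_extension cU lU|exact: lsf.1].
(* The extension of the projection of [l] has the slice values of [l], hence its germ. *)
- move=> _ [l ll <-]; rewrite germ_projectionE; last exact: ll.1.
  have cU := projection_conformal openA ll.
  have lU := is_extension_exists p openA cU.1.
  rewrite (germ_extension_eq openA lU).
  apply: (germ_projection_inj openA lU.1 ll.1).
  exact: projection_extension cU lU.
- move=> U cU; have lU := is_extension_exists p openA cU.1.
  rewrite (germ_extension_eq openA lU) germ_projectionE; last exact: lU.1.
  exact: projection_extension cU lU.
Qed.
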